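(* Let $\{A_0=I_{n-1}, A_1, A_2={}^tA_1\}$ be a non-symmetric association scheme of rank $3$ and order $n-1$, put $a=n-1$, and let $\mathcal{Q}=\{\sigma_k\mid k\in K\}\cup\{\tau_g\mid g\in G\setminus K\}$ be the association scheme of order $4n$ constructed from it in the context. Then $\mathcal{Q}$ has exactly five irreducible characters $\varphi_1,\dots,\varphi_5$, and its character table, with the multiplicities $m_{\varphi_i}$ in the last column, is $$\begin{array}{c|rrrrrrrr|c} &\sigma_1&\sigma_{x^2}&\sigma_x&\sigma_{x^3}&\tau_{xy}&\tau_{x^3y}&\tau_{y}&\tau_{x^2y}&m_{\varphi_i}\\ \hline \varphi_1&1&1&1&1&a&a&a&a&1\\ \varphi_2&1&1&-1&-1&a&a&-a&-a&1\\ \varphi_3&1&1&1&1&-1&-1&-1&-1&a\\ \varphi_4&1&1&-1&-1&-1&-1&1&1&a\\ \varphi_5&2&-2&0&0&0&0&0&0&n \end{array}$$ The Frobenius-Schur indicators are $\nu(\varphi_i)=1$ for $i=1,2,3,4$ and $\nu(\varphi_5)=-1$.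
   Context: ${}^tM$ is the transpose of $M$, $I_N$ the $N\times N$ identity matrix, $J_N$ the $N\times N$ all-ones matrix, $\otimes$ the Kronecker product. Association scheme: a set $\mathcal{S}=\{S_0,\dots,S_d\}$ of $d+1$ non-zero $N\times N$ matrices with entries in $\{0,1\}$ is an association scheme of order $N$ and rank $d+1$ if (1) $S_0=I_N$; (2) $\sum_{i=0}^d S_i=J_N$; (3) for all $0\le i,j\le d$, ${}^tS_i$ and $S_iS_j$ are linear combinations of $S_0,\dots,S_d$. It is symmetric if ${}^tS_i=S_i$ for all $i$, and non-symmetric otherwise. All rows of $S_i$ contain the same number of ones, called the valency $n_i$ of $S_i$. Characters: $\mathbb{C}\mathcal{S}=\bigoplus_i\mathbb{C}S_i$ is the adjacency algebra over $\mathbb{C}$; it is a semisimple subalgebra of the $N\times N$ complex matrices. $\mathrm{Irr}(\mathcal{S})$ is the set of irreducible characters of $\mathbb{C}\mathcal{S}$ (traces of irreducible representations), and the character table is the matrix $(\chi(S_j))_{\chi\in\mathrm{Irr}(\mathcal{S}),\,0\le j\le d}$. The standard representation is $S_i\mapsto S_i$; writing its character as $\sum_{\chi\in\mathrm{Irr}(\mathcal{S})}m_\chi\chi$, the coefficient $m_\chi$ is the multiplicity of $\chi$. The Frobenius-Schur indicator of $\chi\in\mathrm{Irr}(\mathcal{S})$ is $$\nu(\chi)=\frac{m_\chi}{N\chi(S_0)}\sum_{i=0}^d\frac{1}{n_i}\chi(S_i^2).$$ Group: let $x,y$ be the permutation matrices $$x=\begin{pmatrix}0&1&0&0\\0&0&1&0\\0&0&0&1\\1&0&0&0\end{pmatrix},\quad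 y=\begin{pmatrix}0&1&0&0\\1&0&0&0\\0&0&0&1\\0&0&1&0\end{pmatrix}$$ and $G=\langle x,y\rangle\cong D_8$ the group of order $8$ generated by them under matrix multiplication; its identity is $1=I_4$. Let $K=C_G(x)=\{1,x,x^2,x^3\}$, so $G\setminus K=\{y,xy,x^2y,x^3y\}$. Construction of $\mathcal{Q}$: given the scheme $\{A_0,A_1,A_2\}$ of order $n-1$ (it is known that then $n\equiv 0\pmod 4$), define $n\times n$ block matrices (blocks of sizes $1$ and $n-1$; $\mathbf{1}$ is the all-ones row vector of length $n-1$) $$\hat{A}_1=\begin{pmatrix}0&\mathbf{1}\\ 0&A_1\end{pmatrix},\qquad \hat{A}_2=\begin{pmatrix}0&0\\ {}^t\mathbf{1}&A_2\end{pmatrix}.$$ Define $4n\times 4n$ matrices $\sigma_k=I_n\otimes k$ for $k\in K$ and $\tau_g=\hat{A}_1\otimes g+\hat{A}_2\otimes gx^2$ for $g\in G\setminus K$. The set $\mathcal{Q}$ of these $8$ matrices is an association scheme of order $4n$ with identity element $\sigma_1$. *)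

(* Defs.v *)
From HB Require Import structures.
From mathcomp Require Import all_boot all_order all_algebra all_fingroup.
From mathcomp Require Import finmap reals.
From mathcomp Require Import mxtens complex.

Set Implicit Arguments.
Unset Strict Implicit.
Unset Printing Implicit Defensive.

Import GRing.Theory.
Local Open Scope ring_scope.

Section AssociationSchemes.
Variables (F : fieldType) (N : nat).
Implicit Types (S : {fset 'M[F]_N}) (chi : 'M[F]_N -> F).

(* For an association scheme this linear span is closed under products. *)
Definition adjacency_algebra S : {vspace 'M[F]_N} := <<enum_fset S>>%VS.

Definition association_scheme S : Prop :=
  [/\ forall M, M \in S -> M != 0 /\ forall i j, M i j = 0 \/ M i j = 1,
      1%:M \in S,
      \sum_(M <- S) M = const_mx 1,
      {in S, forall M, M^T \in adjacency_algebra S}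
    & {in S &, forall M M', M *m M' \in adjacency_algebra S}].

Definition symmetric_scheme S : Prop := {in S, forall M, M^T = M}.

(* The number of ones in an arbitrarily chosen row: in an association scheme
   all rows have the same number of ones. *)
Definition valency (M : 'M[F]_N) : nat :=
  if [pick i : 'I_N] is Some i then #|[pred j | M i j == 1]| else 0.

(* Only the values of rho on the adjacency algebra matter. *)
Definition representation S (m : nat) (rho : 'M[F]_N -> 'M[F]_m) : Prop :=
  [/\ forall c, {in adjacency_algebra S &, forall u v,
        rho (c *: u + v) = c *: rho u + rho v},
      {in adjacency_algebra S &, forall u v, rho (u *m v) = rho u *m rho v}
    & rho 1%:M = 1%:M].

Definition irreducible_representation S (m : nat)
    (rho : 'M[F]_N -> 'M[F]_m) : Prop :=
  [/\ representation S rho, (0 < m)%N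
    & forall U : {vspace 'cV[F]_m},
        (forall u w, u \in adjacency_algebra S -> w \in U -> rho u *m w \in U) ->
        U = 0%VS \/ U = fullv].

(* Characters are functions on the adjacency algebra, hence are compared only
   on that subspace. *)
Definition irreducible_character S chi : Prop :=
  exists m (rho : 'M[F]_N -> 'M[F]_m),
    irreducible_representation S rho /\
    {in adjacency_algebra S, forall u, chi u = \tr (rho u)}.

(* phi lists Irr(S), without repetition. *)
Definition irreducible_characters S (r : nat)
    (phi : 'I_r -> 'M[F]_N -> F) : Prop :=
  [/\ forall i, irreducible_character S (phi i),
      forall i j, {in adjacency_algebra S, phi i =1 phi j} -> i = j
    & forall chi, irreducible_character S chi ->
        exists i, {in adjacency_algebra S, chi =1 phi i}].

(* The standard character is u |-> \tr u. *)
Definition multiplicities S (r : nat) (phi : 'I_r -> 'M[F]_N -> F)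
    (m : 'I_r -> nat) : Prop :=
  {in adjacency_algebra S, forall u, \tr u = \sum_i (m i)%:R * phi i u}.

(* m stands for the multiplicity of chi. *)
Definition frobenius_schur S chi (m : nat) : F :=
  m%:R / (N%:R * chi 1%:M) * \sum_(M <- S) (valency M)%:R^-1 * chi (M *m M).

End AssociationSchemes.

(* The group G generated by the matrices x and y is represented inside 'S_4
   through the injective morphism perm_mx, see perm_mx_gx and perm_mx_gy. *)
Definition gx : 'S_4 := perm (@ordS_inj 4).
Definition gy : 'S_4 := (tperm (inord 0) (inord 1) * tperm (inord 2) (inord 3))%g.
Definition groupG : {group 'S_4} := <<[set gx; gy]>>%G.
Definition groupK : {group 'S_4} := 'C_groupG[gx]%G.

Definition mx_of_rows (R : pzRingType) n (s : seq (seq R)) : 'M[R]_n :=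
  \matrix_(i, j) nth 0 (nth [::] s i) j.

Lemma perm_mx_gx (R : pzRingType) :
  perm_mx gx = mx_of_rows 4 [:: [:: 0; 1; 0; 0];
                                [:: 0; 0; 1; 0];
                                [:: 0; 0; 0; 1];
                                [:: 1; 0; 0; 0]] :> 'M[R]_4.
Proof.
apply/matrixP => i j; rewrite !mxE permE -val_eqE /=.
by case: i => [[|[|[|[|//]]]]] ?; case: j => [[|[|[|[|//]]]]] ?.
Qed.

Lemma perm_mx_gy (R : pzRingType) :
  perm_mx gy = mx_of_rows 4 [:: [:: 0; 1; 0; 0];
                                [:: 1; 0; 0; 0];
                                [:: 0; 0; 0; 1];
                                [:: 0; 0; 1; 0]] :> 'M[R]_4.
Proof.
apply/matrixP => i j; rewrite !mxE !permE /= !permE /=.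
by case: i => [[|[|[|[|//]]]]] ?; case: j => [[|[|[|[|//]]]]] ?;
   do ![rewrite -!val_eqE /= ?inordK //=].
Qed.

Section Construction.
Variables (F : fieldType) (a : nat).
Implicit Types (A : 'M[F]_a).

Definition hatA1 A1 : 'M[F]_(1 + a) := block_mx 0 (const_mx 1) 0 A1.
Definition hatA2 A2 : 'M[F]_(1 + a) := block_mx 0 0 (const_mx 1) A2.

Definition sigma (k : 'S_4) : 'M[F]_((1 + a) * 4) := 1%:M *t perm_mx k.

Definition tau A1 A2 (g : 'S_4) : 'M[F]_((1 + a) * 4) :=
  hatA1 A1 *t perm_mx g + hatA2 A2 *t perm_mx (g * gx ^+ 2)%g.

Definition schemeQ A1 A2 : {fset 'M[F]_((1 + a) * 4)} :=
  ([fset sigma k | k in groupK]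
   `|` [fset tau A1 A2 g | g in groupG :\: groupK])%fset.

End Construction.

(* Main.v *)
Require Import Defs.
From HB Require Import structures.
From mathcomp Require Import all_boot all_order all_algebra all_fingroup.
From mathcomp Require Import finmap reals.
From mathcomp Require Import mxtens complex.
From mathcomp Require Import ring.

Set Implicit Arguments.
Unset Strict Implicit.
Unset Printing Implicit Defensive.

(* Put k = (a - 1) / 2, z = x^2 and C = hatA1 - hatA2.  The parameters of a
   non-symmetric rank 3 scheme are forced, and give C^2 = -a, while
   hatA1 + hatA2 = J - I.  Hence, for g outside K,
     tau_g^2 = a sigma_z + k (tau_xy + tau_x^3y).
   Writing X, T for the images of sigma_x, tau_xy in an irreducible
   representation, one has X^4 = 1, TX = X^3 T and T^2 = a X^2 + k (T + X^2 T),
   so that X^2 is central and by Schur's lemma X^2 = 1 or X^2 = -1.  If X^2 = 1,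
   everything commutes, X = 1 or -1 and (T - a)(T + 1) = 0: these are the four
   characters of degree 1.  If X^2 = -1, then TX = -XT and T^2 = -a, a
   quaternion algebra: the degree is 2 and X, T, XT have trace 0.
   Conversely, every character is realised on a submodule of the standard
   module spanned by vectors v (x) p, where v is an eigenvector of
   hatA1 + e hatA2 and p runs over a G-submodule of the permutation module of
   dimension 4 on which z acts as e = 1 or -1. *)

Import Order.TTheory GRing.Theory Num.Theory.
Local Open Scope ring_scope.

(** * Linear induction over the adjacency algebra *)

Section AdjacencyAlgebra.
Variables (F : fieldType) (N : nat) (S : {fset 'M[F]_N}).

Lemma mem_adjacency M : M \in S -> M \in adjacency_algebra S.
Proof. exact: memv_span. Qed.

Lemma adjacency_ind (P : 'M[F]_N -> Prop) :
    P 0 -> {in S, forall M, P M} ->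
    (forall c, {in adjacency_algebra S &, forall u v,
       P u -> P v -> P (c *: u + v)}) ->
  {in adjacency_algebra S, forall u, P u}.
Proof.
move=> P0 PS PD u.
rewrite [u \in _](_ : _ = (u \in <<in_tuple (enum_fset S)>>%VS)) //.
move/coord_span => ->.
(* Membership in the algebra is carried along the sum, because [PD] demands it of both arguments. *)
pose Q v := v \in adjacency_algebra S /\ P v.
suff [] : Q (\sum_i coord (in_tuple (enum_fset S)) i u *: (in_tuple (enum_fset S))`_i) by [].
elim/big_rec: _ => [|i v _ [Av Pv]]; first by split=> //; exact: mem0v.
have Si : (in_tuple (enum_fset S))`_i \in S by exact: mem_nth.
have Ai := mem_adjacency Si.
by split; [rewrite memvD ?memvZ | apply: PD => //; exact: PS].
Qed.

Variables (m : nat) (rho : 'M[F]_N -> 'M[F]_m).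
Hypothesis rho_repr : representation S rho.

Let rhoD c : {in adjacency_algebra S &, forall u v,
  rho (c *: u + v) = c *: rho u + rho v}.
Proof. by have [+ _ _] := rho_repr; apply. Qed.

Lemma repr0 : rho 0 = 0.
Proof.
have := @rhoD 1 0 0 (mem0v _) (mem0v _); rewrite scaler0 scale1r addr0 => e.
by apply: (addIr (rho 0)); rewrite -e add0r.
Qed.

Lemma reprZ c u : u \in adjacency_algebra S -> rho (c *: u) = c *: rho u.
Proof. by move=> Au; rewrite -[c *: u]addr0 rhoD ?mem0v // repr0 addr0. Qed.

Lemma reprD u v : u \in adjacency_algebra S -> v \in adjacency_algebra S ->
  rho (u + v) = rho u + rho v.
Proof. by move=> Au Av; rewrite -[u]scale1r rhoD // !scale1r. Qed.

Lemma repr_ind (P : 'M[F]_m -> Prop) :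
    P 0 -> {in S, forall M, P (rho M)} ->
    (forall c A B, P A -> P B -> P (c *: A + B)) ->
  {in adjacency_algebra S, forall u, P (rho u)}.
Proof.
move=> P0 PS PD; apply: adjacency_ind => //; first by rewrite repr0.
by move=> c u v Au Av Pu Pv; rewrite rhoD //; exact: PD.
Qed.

End AdjacencyAlgebra.

(** * Schur's lemma and degree bounds *)

Section Irreducible.
Variables (F : fieldType) (N : nat) (S : {fset 'M[F]_N}).
Variables (m : nat) (rho : 'M[F]_N -> 'M[F]_m).
Hypothesis rho_irr : irreducible_representation S rho.

Let rho_repr : representation S rho. Proof. by case: rho_irr. Qed.

(** Stabilising [U] is a linear condition, so it need only be tested on the matrices of [S]. *)
Let rho_simple (U : {vspace 'cV[F]_m}) :
  {in S, forall M, forall w, w \in U -> rho M *m w \in U} ->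
  U = 0%VS \/ U = fullv.
Proof.
case: rho_irr => _ _ simple stable; apply: simple => u w Au Uw.
move: u Au; apply: (repr_ind rho_repr (P := fun D => D *m w \in U)) => [|M SM|c A B stA stB].
- by rewrite mul0mx mem0v.
- exact: stable.
- by rewrite mulmxDl -scalemxAl memvD ?memvZ.
Qed.

(* If C commutes with the representation, its kernel is a submodule. *)
Lemma schur_mul0 (C D : 'M[F]_m) :
    {in S, forall M, C *m rho M = rho M *m C} -> C *m D = 0 ->
  C = 0 \/ D = 0.
Proof.
move=> commC CD0.
pose f : 'Hom('cV[F]_m, 'cV[F]_m) := linfun (mulmx C).
have kerE w : (w \in lker f) = (C *m w == 0) by rewrite memv_ker lfunE.
(* The columns of [D] lie in the kernel of [C]: a zero kernel gives [D = 0], a full one [C = 0]. *)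
have [M SM w|K0|K1] := @rho_simple (lker f).
- by rewrite !kerE mulmxA commC // -mulmxA => /eqP->; rewrite mulmx0.
- right; apply/matrixP => i j; rewrite mxE.
  have: col j D \in lker f by rewrite kerE colE mulmxA CD0 mul0mx.
  by rewrite K0 memv0 => /eqP/matrixP/(_ i 0); rewrite !mxE.
- left; apply/matrixP => i j; rewrite mxE.
  have: (delta_mx j 0 : 'cV[F]_m) \in lker f by rewrite K1 memvf.
  by rewrite kerE -colE => /eqP/matrixP/(_ i 0); rewrite !mxE.
Qed.

(** Here [(C - 1) (C + 1) = 0], and one factor vanishes by [schur_mul0]. *)
Lemma schur_involution (C : 'M[F]_m) :
    {in S, forall M, C *m rho M = rho M *m C} -> C *m C = 1%:M ->
  C = 1%:M \/ C = - 1%:M.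
Proof.
move=> commC CC.
have [] := @schur_mul0 (C - 1%:M) (C + 1%:M).
- by move=> M SM; rewrite mulmxBl mulmxBr mul1mx mulmx1 commC.
- by rewrite mulmxDr mulmxBl CC !mulmx1 mul1mx addrC subrKA subrr.
- by move/eqP; rewrite subr_eq0 => /eqP->; left.
- by move/eqP; rewrite addr_eq0 => /eqP->; right.
Qed.

(** Bounds the degree once a small non-zero submodule is exhibited. *)
Lemma irr_dim_le (U : {vspace 'cV[F]_m}) :
    U != 0%VS -> {in S, forall M, forall w, w \in U -> rho M *m w \in U} ->
  (m <= \dim U)%N.
Proof.
move=> nzU /rho_simple[U0|->]; first by rewrite U0 eqxx in nzU.
by rewrite dimvf dim_matrix mulr1.
Qed.

(** Under a scalar action every line is a submodule; the line of the all-ones column is taken. *)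
Lemma irr_scalar_dim : {in S, forall M, is_scalar_mx (rho M)} -> m = 1%N.
Proof.
move=> scal; case: rho_irr => _ m_gt0 _; apply/eqP; rewrite eqn_leq m_gt0 andbT.
pose e : 'cV[F]_m := const_mx 1.
have nz_e : e != 0.
  by apply/eqP => /matrixP/(_ (Ordinal m_gt0) 0)/eqP; rewrite !mxE oner_eq0.
have := @irr_dim_le <[e]>%VS; rewrite dim_vline nz_e; apply=> [|M SM w].
  by rewrite -dimv_eq0 dim_vline nz_e.
by have /is_scalar_mxP[c ->] := scal M SM; rewrite mul_scalar_mx => ?; rewrite memvZ.
Qed.

End Irreducible.

(** * Representations on submodules of the standard module *)

Section Compression.
Variables (F : fieldType) (N m : nat) (S : {fset 'M[F]_N}).
Variables (W : 'M[F]_(m, N)) (V : 'M[F]_(N, m)).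

(** With [W] a left inverse of [V], this is the matrix of [u] in the basis formed by the columns of
    [V]. *)
Definition compression (u : 'M[F]_N) : 'M[F]_m := W *m u *m V.

Hypothesis WV : W *m V = 1%:M.

Lemma compression_eq u D : u *m V = V *m D -> compression u = D.
Proof. by move=> uV; rewrite /compression -mulmxA uV mulmxA WV mul1mx. Qed.

Lemma compressionP c u v :
  compression (c *: u + v) = c *: compression u + compression v.
Proof. by rewrite /compression mulmxDr mulmxDl -scalemxAr -scalemxAl. Qed.

(* The column space of V is a submodule on which u acts as compression u. *)
Lemma compression_repr :
  {in S, forall M, exists D, M *m V = V *m D} -> representation S compression.
Proof.
move=> stable.
have act : {in adjacency_algebra S, forall u, u *m V = V *m compression u}.
  apply: adjacency_ind => [|M SM|c u v _ _ uV vV].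
  - by rewrite /compression mulmx0 !mul0mx mulmx0.
  - by have [D MD] := stable _ SM; rewrite MD (compression_eq MD).
  - by rewrite compressionP mulmxDl mulmxDr -scalemxAl -scalemxAr uV vV.
split=> [c u v _ _|u v Au Av|]; first exact: compressionP.
- apply: compression_eq; rewrite -mulmxA act //.
  by rewrite mulmxA act // mulmxA.
- by apply: compression_eq; rewrite mul1mx mulmx1.
Qed.

End Compression.

(** * Kronecker product identities *)

Section Tensor.
Variables (R : comNzRingType).

Lemma tensmxDl m n p q (A A' : 'M[R]_(m, n)) (B : 'M[R]_(p, q)) :
  (A + A') *t B = A *t B + A' *t B.
Proof.
by apply/matrixP => i j; rewrite !mxE mulrDl.
Qed.

Lemma tensmxDr m n p q (A : 'M[R]_(m, n)) (B B' : 'M[R]_(p, q)) :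
  A *t (B + B') = A *t B + A *t B'.
Proof.
by apply/matrixP => i j; rewrite !mxE mulrDr.
Qed.

Lemma tensmxZl m n p q c (A : 'M[R]_(m, n)) (B : 'M[R]_(p, q)) :
  (c *: A) *t B = c *: (A *t B).
Proof.
by apply/matrixP => i j; rewrite !mxE mulrA.
Qed.

Lemma tensmxZr m n p q c (A : 'M[R]_(m, n)) (B : 'M[R]_(p, q)) :
  A *t (c *: B) = c *: (A *t B).
Proof.
by apply/matrixP => i j; rewrite !mxE mulrCA.
Qed.

Lemma tensmx_const m n p q (c d : R) :
  (const_mx c : 'M_(m, n)) *t (const_mx d : 'M_(p, q)) = const_mx (c * d).
Proof. by apply/matrixP => i j; rewrite !mxE. Qed.

Lemma mulmx_const m n p (c d : R) :
  (const_mx c : 'M_(m, n)) *m (const_mx d : 'M_(n, p)) = const_mx (n%:R * (c * d)).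
Proof.
apply/matrixP => i j; rewrite !mxE; under eq_bigr do rewrite !mxE.
by rewrite sumr_const card_ord mulr_natl.
Qed.

Lemma tensmx1 m n : (1%:M : 'M[R]_m) *t (1%:M : 'M[R]_n) = 1%:M.
Proof.
apply/matrixP => i j; case: (mxtens_indexP i) => ? ?; case: (mxtens_indexP j) => ? ?.
by rewrite tensmxE !mxE -natrM mulnb (can_eq (@mxtens_indexK _ _)) xpair_eqE.
Qed.

Lemma mxtrace_tens m n (A : 'M[R]_m) (B : 'M[R]_n) : \tr (A *t B) = \tr A * \tr B.
Proof.
rewrite /mxtrace mulr_sum.
by apply: eq_bigr => k _; case: (mxtens_indexP k) => i j; rewrite tensmxE mxtens_indexK.
Qed.

End Tensor.

(** * The dihedral group of order 8 and the centraliser of its rotation *)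

Section DihedralGroup.
Local Open Scope group_scope.

Lemma gxE (i : 'I_4) : gx i = inord (i.+1 %% 4).
Proof. by apply: val_inj; rewrite permE /= inordK // ltn_mod. Qed.

Lemma gyE (i : 'I_4) : gy i = inord (nth 0 [:: 1; 0; 3; 2]%N i).
Proof.
apply: val_inj; rewrite !permE /= !permE /=.
by case: i => [[|[|[|[|//]]]]] ?; do ![rewrite -!val_eqE /= ?inordK //=].
Qed.

Lemma gx4 : gx ^+ 4 = 1.
Proof.
apply/permP => i; apply: val_inj; rewrite !expgS expg0 !permM !perm1 !gxE.
by case: i => [[|[|[|[|//]]]]] ?; rewrite /= !inordK.
Qed.

Lemma gy2 : gy ^+ 2 = 1.
Proof.
apply/permP => i; apply: val_inj; rewrite expgS expg1 permM perm1 !gyE.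
by case: i => [[|[|[|[|//]]]]] ?; rewrite /= !inordK.
Qed.

Lemma gyx : gy * gx = gx ^+ 3 * gy.
Proof.
apply/permP => i; apply: val_inj; rewrite !expgS expg0 mulg1 (permM gy) (permM _ gy).
rewrite !(permM gx) !gxE !gyE.
by case: i => [[|[|[|[|//]]]]] ?; rewrite /= ?inordK //= ?inordK.
Qed.

(** Separates the four powers of [gx] by their value at 0. *)
Lemma gx_val0 i : (i < 4)%N -> (gx ^+ i) ord0 = i :> nat.
Proof.
elim: i => [|i IH] lti; first by rewrite expg0 perm1.
by rewrite expgSr (permM _ gx) gxE IH ?(ltnW lti) // modn_small // inordK.
Qed.

Lemma gx2_neq1 : gx ^+ 2 != 1.
Proof.
apply/eqP => /(congr1 (fun g : 'S_4 => nat_of_ord (g ord0))).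
by rewrite gx_val0 // perm1.
Qed.

(** * Consequences of the dihedral relations in an abstract group *)

Section DihedralPresentation.
Variables (gT : finGroupType) (x y : gT).
Hypotheses (x4 : x ^+ 4 = 1) (y2 : y ^+ 2 = 1) (yx : y * x = x ^+ 3 * y).
Hypothesis x2_neq1 : x ^+ 2 != 1.
Let G := <<[set x; y]>>.

Lemma dihedral_comm i : y * x ^+ i = x ^+ (3 * i) * y.
Proof.
elim: i => [|i IH]; first by rewrite muln0 !expg0 mulg1 mul1g.
by rewrite expgSr mulgA IH -mulgA yx mulgA -expgD mulnSr.
Qed.

(** A generator is multiplied on the left of a word in normal form; [dihedral_comm] moves [y] past
    the power of [x]. *)
Lemma dihedral_elt g : g \in G -> exists i j, g = x ^+ i * y ^+ j.
Proof.
case/gen_prodgP => n [c c_in ->].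
elim/big_rec: _ => [|k _ _ [i [j ->]]].
  by exists 0, 0; rewrite !expg0 mulg1.
have := c_in k; rewrite !inE => /orP[] /eqP->.
  by exists i.+1, j; rewrite mulgA -expgS.
by exists (3 * i)%N, j.+1; rewrite mulgA dihedral_comm -mulgA -expgS.
Qed.

Let Gx : x \in G. Proof. by rewrite mem_gen ?inE ?eqxx. Qed.
Let Gy : y \in G. Proof. by rewrite mem_gen ?inE ?eqxx ?orbT. Qed.

(** Commuting with [x] would give [x ^+ (i + 3) = x ^+ i.+1], that is [x ^+ 2 = 1]. *)
Let Xy_notin i : x ^+ i * y \notin 'C_G[x].
Proof.
apply/negP; rewrite inE => /andP[_ /cent1P]; rewrite /commute -mulgA yx mulgA [RHS]mulgA.
move/mulIg. rewrite -expgD -expgS (_ : i + 3 = i.+1 + 2)%N ?expgD; last first.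
  by rewrite addnS.
by rewrite -[RHS]mulg1 => /mulgI/eqP; rewrite (negPf x2_neq1).
Qed.

Lemma dihedral_cent1 : 'C_G[x] =i [:: 1; x ^+ 2; x; x ^+ 3].
Proof.
move=> g; apply/idP/idP => [Kg | ].
  have /dihedral_elt[i [j gE]] : g \in G by move: Kg; rewrite inE => /andP[].
  (* Reducing the exponents modulo 4 and 2 leaves finitely many words. *)
  move: Kg; rewrite {}gE -(expg_mod j y2) -(expg_mod i x4).
  have : (j %% 2 < 2)%N by rewrite ltn_mod.
  case: (j %% 2)%N => [|[|//]] _; last by rewrite expg1 (negPf (Xy_notin _)).
  rewrite expg0 mulg1 => _; have : (i %% 4 < 4)%N by rewrite ltn_mod.
  by case: (i %% 4)%N => [|[|[|[|//]]]] _; rewrite ?expg0 ?expg1 !inE eqxx ?orbT.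
have XK i : x ^+ i \in 'C_G[x].
  by rewrite inE groupX //=; apply/cent1P/commute_sym/commuteX.
rewrite !in_cons in_nil orbF => /or4P[] /eqP->;
  [by have := XK 0; rewrite expg0 | exact: (XK 2)
  | by have := XK 1%N; rewrite expg1 | exact: (XK 3)].
Qed.

Lemma dihedral_cent1C :
  G :\: 'C_G[x] =i [:: x * y; x ^+ 3 * y; y; x ^+ 2 * y].
Proof.
move=> g; rewrite in_setD; apply/idP/idP => [/andP[nKg /dihedral_elt[i [j gE]]] | ].
  move: nKg; rewrite {}gE -(expg_mod j y2) -(expg_mod i x4).
  have : (i %% 4 < 4)%N by rewrite ltn_mod.
  have : (j %% 2 < 2)%N by rewrite ltn_mod.
  case: (j %% 2)%N => [|[|//]] _; case: (i %% 4)%N => [|[|[|[|//]]]] _;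
    rewrite ?dihedral_cent1 ?(expg0, expg1) ?(mulg1, mul1g) !inE eqxx ?orbT //.
have XYG i : (x ^+ i * y \notin 'C_G[x]) && (x ^+ i * y \in G).
  by rewrite Xy_notin groupM ?groupX.
rewrite !in_cons in_nil orbF => /or4P[] /eqP->;
  [by have := XYG 1%N; rewrite expg1 | exact: (XYG 3)
  | by have := XYG 0; rewrite expg0 mul1g | exact: (XYG 2)].
Qed.

End DihedralPresentation.

Lemma groupKE : groupK =i [:: 1; gx ^+ 2; gx; gx ^+ 3].
Proof. exact: (dihedral_cent1 gx4 gy2 gyx gx2_neq1). Qed.

Lemma groupGDKE : groupG :\: groupK =i [:: gx * gy; gx ^+ 3 * gy; gy; gx ^+ 2 * gy].
Proof. exact: (dihedral_cent1C gx4 gy2 gyx gx2_neq1). Qed.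

Lemma groupK_uniq : uniq [:: 1; gx ^+ 2; gx; gx ^+ 3].
Proof.
apply: (@map_uniq _ _ (fun g : 'S_4 => nat_of_ord (g ord0))).
by rewrite /= -{2}[gx]expg1 !gx_val0 // perm1.
Qed.

Lemma groupGDK_uniq : uniq [:: gx * gy; gx ^+ 3 * gy; gy; gx ^+ 2 * gy].
Proof.
(* Cancelling [gy] on the right turns the list into that of [groupK], rotated by two places. *)
apply: (@map_uniq _ _ (mulg^~ gy^-1)); rewrite [map _ _]/= !(mulgK gy) mulgV.
by rewrite -[X in uniq X]/(rot 2 [:: 1; gx ^+ 2; gx; gx ^+ 3]) rot_uniq groupK_uniq.
Qed.

End DihedralGroup.

(** * Parameters of a non-symmetric scheme of rank 3 *)

Section RankThreeScheme.
Variables (F : numFieldType) (a : nat) (A1 A2 : 'M[F]_a).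
Hypothesis A2E : A2 = A1^T.
Hypothesis schemeA : association_scheme [fset 1%:M; A1; A2]%fset.
Hypothesis rankA : #|` [fset 1%:M; A1; A2]%fset| = 3%N.

(** The common valency of [A1] and [A2], as an element of [F]. *)
Let k : F := 2^-1 * (a%:R - 1).

Let distinct : [/\ 1%:M != A1, 1%:M != A2 & A1 != A2].
Proof.
move: rankA; rewrite fsetUC cardfsU1 cardfs2 !inE eq_sym.
by case: eqP; case: eqP; case: eqP => //= *; split; apply/eqP=> // /esym.
Qed.

Lemma scheme3_sum : A1 + A2 = const_mx 1 - 1%:M.
Proof.
case: schemeA => _ _ <- _ _; have [n1 n2 n3] := distinct.
rewrite fsetUC big_fsetU1 /= ?inE ?negb_or 1?eq_sym ?n2 1?eq_sym ?n3 //.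
rewrite big_fsetU1 ?inE //= big_seq_fset1.
by apply/matrixP => i j; rewrite !mxE; ring.
Qed.

Lemma scheme3_01 i j : A1 i j = 0 \/ A1 i j = 1.
Proof. by case: schemeA => /(_ A1) H _ _ _ _; apply: (H _).2; rewrite !inE eqxx orbT. Qed.

Let sumE i j : A1 i j + A1 j i = 1 - (i == j)%:R.
Proof. by move: scheme3_sum; rewrite A2E => /matrixP/(_ i j); rewrite !mxE. Qed.

Let sqr01 i j : A1 i j * A1 i j = A1 i j.
Proof. by have [->|->] := scheme3_01 i j; rewrite ?mul0r ?mul1r. Qed.

Let spanE u : u \in adjacency_algebra [fset 1%:M; A1; A2]%fset ->
  exists c d e, u = c%:M + d *: A1 + e *: A2.
Proof.
move: u; apply: adjacency_ind => [|M|r u v _ _ [c [d [e ->]]] [c' [d' [e' ->]]]].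
- by exists 0, 0, 0; rewrite !scale0r raddf0 !addr0.
- rewrite !inE => /orP[/orP[]|] /eqP->.
  + by exists 1, 0, 0; rewrite !scale0r !addr0.
  + by exists 0, 1, 0; rewrite scale1r scale0r raddf0 add0r addr0.
  + by exists 0, 0, 1; rewrite scale1r scale0r raddf0 !add0r.
- exists (r * c + c'), (r * d + d'), (r * e + e').
  by apply/matrixP => i j; rewrite !mxE mulrnDl -mulrnAr; ring.
Qed.

Let mulA (B C : 'M[F]_a) : B \in [fset 1%:M; A1; A2]%fset ->
    C \in [fset 1%:M; A1; A2]%fset ->
  exists c d e, B *m C = c%:M + d *: A1 + e *: A2.
Proof. by case: schemeA => _ _ _ _ H SB SC; apply: spanE; apply: H. Qed.

Let in1 : A1 \in [fset 1%:M; A1; A2]%fset. Proof. by rewrite !inE eqxx orbT. Qed.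
Let in2 : A2 \in [fset 1%:M; A1; A2]%fset. Proof. by rewrite !inE eqxx orbT. Qed.

Let A1neq0 : A1 != 0. Proof. by case: schemeA => /(_ A1) H _ _ _ _; exact: (H _).1. Qed.

Lemma scheme3_order_gt0 : (0 < a)%N.
Proof.
case: (posnP a) => // a0; case/eqP: A1neq0; apply/matrixP => i.
by move: (ltn_ord i); rewrite {2}a0.
Qed.

(** Subtracting the transpose gives [(d - e) *: (A1 - A2) = 0], hence [d = e], and only
    [A1 + A2 = J - I] occurs. *)
Let symm_coeffs B : B^T = B -> (exists c d e, B = c%:M + d *: A1 + e *: A2) ->
  exists c d, B = c%:M + d *: (const_mx 1 - 1%:M).
Proof.
move=> symB [c [d [e BE]]].
have : (d - e) *: (A1 - A2) = 0.
  have : B - B^T = 0 by rewrite symB subrr.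
  rewrite {}BE !linearD !linearZ /= tr_scalar_mx A2E trmxK => E.
  by rewrite -[RHS]E; apply/matrixP => i j; rewrite !mxE; ring.
move/eqP; rewrite scaler_eq0 !subr_eq0; have [_ _ /negPf->] := distinct.
by rewrite orbF => /eqP de; exists c, d; rewrite BE -de -scheme3_sum scalerDr addrA.
Qed.

(** Both products are symmetric, being [A1 *m A1^T] and [A1^T *m A1]. *)
Let prods : exists c d c' d',
  A1 *m A2 = c%:M + d *: (const_mx 1 - 1%:M) /\
  A2 *m A1 = c'%:M + d' *: (const_mx 1 - 1%:M).
Proof.
have [||c [d E]] := @symm_coeffs (A1 *m A2); rewrite ?trmx_mul ?A2E ?trmxK -?A2E //.
  exact: mulA.
have [||c' [d' E']] := @symm_coeffs (A2 *m A1); rewrite ?trmx_mul ?A2E ?trmxK -?A2E //.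
  exact: mulA.
by exists c, d, c', d'.
Qed.

(** As the entries are 0 or 1, the diagonals of [A1 *m A2] and [A2 *m A1] hold the row and column
    sums of [A1], which are therefore constant. Summing all entries in two ways identifies the two
    constants, and [A1 + A1^T = J - I] gives their value. *)
Let sums : (forall i, \sum_j A1 i j = k) /\ (forall j, \sum_i A1 i j = k).
Proof.
have [c [d [c' [d' [E E']]]]] := prods.
have rowE i : \sum_j A1 i j = c.
  move/matrixP/(_ i i): E; rewrite !mxE eqxx subrr mulr0 addr0 mulr1n => <-.
  by apply: eq_bigr => j _; rewrite A2E mxE sqr01.
have colE j : \sum_i A1 i j = c'.
  move/matrixP/(_ j j): E'; rewrite !mxE eqxx subrr mulr0 addr0 mulr1n => <-.
  by apply: eq_bigr => i _; rewrite A2E mxE sqr01.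
have cc' : c = c'.
  have : \sum_i \sum_j A1 i j = \sum_j \sum_i A1 i j by rewrite exchange_big.
  under eq_bigr do rewrite rowE; under [RHS]eq_bigr do rewrite colE.
  rewrite !sumr_const card_ord => /eqP; rewrite eqrMn2r => /orP[/eqP a0|/eqP //].
  by have := scheme3_order_gt0; rewrite a0.
have kE : k = c.
  have i0 := Ordinal scheme3_order_gt0.
  have : \sum_j (A1 i0 j + A1 j i0) = \sum_j (1 - (i0 == j)%:R).
    by apply: eq_bigr => j _; exact: sumE.
  rewrite big_split /= rowE colE -cc' sumrB sumr_const card_ord.
  rewrite (bigD1 i0) //= eqxx big1 ?addr0 => [|j /negPf]; last first.
    by rewrite eq_sym => ->.
  by rewrite /k => <-; field.
by rewrite kE {2}cc'.
Qed.

Lemma scheme3_row i : \sum_j A1 i j = k. Proof. by case: sums. Qed.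
Lemma scheme3_col j : \sum_i A1 i j = k. Proof. by case: sums. Qed.

Let order_k : a%:R = 2 * k + 1.
Proof. by rewrite /k; field. Qed.

(** Entries are non-negative, so zero row sums would force [A1 = 0]. This allows [k] to be cancelled
    in [mul_coeffs]. *)
Let k_neq0 : k != 0.
Proof.
apply/eqP => k0; case/eqP: A1neq0; apply/matrixP => i j; rewrite mxE.
have A1_ge0 j' : true -> 0 <= A1 i j'.
  by move=> _; have [->|->] := scheme3_01 i j'; rewrite ?ler01.
have /eqP := scheme3_row i; rewrite k0 psumr_eq0 // => /allP/(_ j).
by rewrite mem_index_enum => /(_ isT)/eqP.
Qed.

(** The diagonal gives [c = k]; the row sum [k * k = c + d * (2 * k)] then determines [d]. *)
Let mul_coeffs (B C : 'M[F]_a) c d : (forall i, \sum_j B i j = k) ->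
    (forall i, \sum_j C i j = k) -> (forall i, (B *m C) i i = k) ->
    B *m C = c%:M + d *: (const_mx 1 - 1%:M) ->
  B *m C = k%:M + (2^-1 * (k - 1)) *: (const_mx 1 - 1%:M).
Proof.
move=> rowB rowC diag E; have i0 := Ordinal scheme3_order_gt0.
have ck : c = k by rewrite -(diag i0) E !mxE eqxx subrr mulr0 addr0 mulr1n.
have : \sum_j (B *m C) i0 j = k * k.
  under eq_bigr do rewrite mxE.
  rewrite exchange_big /= -{1}(rowB i0) mulr_suml.
  by apply: eq_bigr => l _; rewrite -mulr_sumr rowC.
rewrite E; under eq_bigr => j do rewrite !mxE.
rewrite big_split /= -mulr_sumr sumrB sumr_const card_ord.
have sum_delta (x : F) : \sum_(j < a) x *+ (i0 == j) = x.
  by rewrite (bigD1 i0) //= eqxx big1 ?addr0 // => j /negPf; rewrite eq_sym => ->.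
rewrite !sum_delta ck order_k addrK => kk.
have -> // : d = 2^-1 * (k - 1).
apply: (mulfI k_neq0); have -> : k * (2^-1 * (k - 1)) = 2^-1 * (k * k - k) by ring.
by rewrite -kk; field.
Qed.

Let rowA2 i : \sum_j A2 i j = k.
Proof. by rewrite -(scheme3_col i); apply: eq_bigr => j _; rewrite A2E mxE. Qed.

Lemma scheme3_mul12 : A1 *m A2 = k%:M + (2^-1 * (k - 1)) *: (const_mx 1 - 1%:M).
Proof.
have [c [d [_ [_ [E _]]]]] := prods.
apply: (mul_coeffs scheme3_row rowA2 _ E) => i.
rewrite mxE -(scheme3_row i); apply: eq_bigr => j _.
by rewrite A2E mxE sqr01.
Qed.

Lemma scheme3_mul21 : A2 *m A1 = k%:M + (2^-1 * (k - 1)) *: (const_mx 1 - 1%:M).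
Proof.
have [_ [_ [c [d [_ E]]]]] := prods.
apply: (mul_coeffs rowA2 scheme3_row _ E) => i.
rewrite mxE -(scheme3_col i); apply: eq_bigr => j _.
by rewrite A2E mxE sqr01.
Qed.

(** Passing through the square of [A1 + A2] leaves only the mixed products, which are known, and
    avoids [A1 *m A1] and [A2 *m A2]. *)
Lemma scheme3_skew_sqr :
  (A1 - A2) *m (A1 - A2) = const_mx 1 - a%:R%:M.
Proof.
have -> : (A1 - A2) *m (A1 - A2) =
    (A1 + A2) *m (A1 + A2) - 2 *: (A1 *m A2 + A2 *m A1).
  rewrite !mulmxDl !mulmxDr !mulmxN !mulNmx.
  by apply/matrixP => i j; rewrite !mxE; ring.
rewrite scheme3_mul12 scheme3_mul21 scheme3_sum.
rewrite mulmxBl mulmxBr mul1mx mulmx1 mulmx_const order_k.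
by apply/matrixP => i j; rewrite !mxE; case: (i == j); rewrite ?mulr1n ?mulr0n; field.
Qed.

End RankThreeScheme.

(** * The bordered matrices: a skew conference matrix and its consequences *)

Section Hats.
Variables (F : numFieldType) (a : nat) (A1 A2 : 'M[F]_a).
Hypothesis A2E : A2 = A1^T.
Hypothesis schemeA : association_scheme [fset 1%:M; A1; A2]%fset.
Hypothesis rankA : #|` [fset 1%:M; A1; A2]%fset| = 3%N.

Let B1 := hatA1 A1.
Let B2 := hatA2 A2.
Let sumA := scheme3_sum schemeA rankA.

Lemma hat_sum : B1 + B2 = const_mx 1 - 1%:M.
Proof.
rewrite /B1 /B2 /hatA1 /hatA2 add_block_mx !addr0 !add0r sumA.
have -> : (const_mx 1 : 'M[F]_(1 + a)) =
    block_mx (const_mx 1) (const_mx 1) (const_mx 1) (const_mx 1).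
  by rewrite -[LHS]submxK; congr block_mx; apply/matrixP => i j; rewrite !mxE.
rewrite (@scalar_mx_block _ 1 a) opp_block_mx add_block_mx !oppr0 !addr0.
by congr block_mx; apply/matrixP => i j; rewrite !ord1 !mxE subrr.
Qed.

(** The border contributes -J to the lower right block, which cancels the J of [scheme3_skew_sqr];
    the off-diagonal blocks vanish because the row and column sums of [A1] agree. *)
Lemma hat_diff_sqr : (B1 - B2) *m (B1 - B2) = - a%:R%:M.
Proof.
rewrite /B1 /B2 /hatA1 /hatA2 opp_block_mx add_block_mx !oppr0 !addr0 add0r.
rewrite mulmx_block !mul0mx !mulmx0 !add0r mulmxN mulNmx !mulmx_const.
rewrite (scheme3_skew_sqr A2E schemeA rankA).
have rowC : (const_mx 1 : 'rV_a) *m (A1 - A2) = 0.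
  apply/matrixP => i j; rewrite !mxE.
  transitivity (\sum_l A1 l j - \sum_l A1 j l).
    by rewrite -sumrB; apply: eq_bigr => l _; rewrite !mxE mul1r A2E mxE.
  by rewrite (scheme3_col A2E schemeA rankA) (scheme3_row A2E schemeA rankA) subrr.
have colC : (A1 - A2) *m (const_mx 1 : 'cV_a) = 0.
  rewrite -[LHS]trmxK trmx_mul trmx_const linearB /= A2E trmxK -A2E -opprB.
  by rewrite mulmxN rowC oppr0 trmx0.
rewrite rowC mulmxN colC oppr0 (@scalar_mx_block _ 1 a) opp_block_mx !oppr0.
congr block_mx; apply/matrixP => i j; rewrite ?ord1 !mxE !mul1r.
  by rewrite mulr1 eqxx.
by rewrite addKr.
Qed.

(** Polarisation: twice the left side is the sum of the squares of [B1 + B2] and [B1 - B2], both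
    known. Their difference gives [hat_mul_sum]. *)
Lemma hat_sqr_sum :
  B1 *m B1 + B2 *m B2 = (2^-1 * (a%:R - 1)) *: (B1 + B2).
Proof.
apply: (@scalerI _ _ 2); first by rewrite pnatr_eq0.
transitivity ((B1 + B2) *m (B1 + B2) + (B1 - B2) *m (B1 - B2)).
  rewrite !mulmxDl !mulmxDr !mulmxN !mulNmx.
  by apply/matrixP => i j; rewrite !mxE; ring.
rewrite hat_diff_sqr hat_sum mulmxBl mulmxBr mul1mx mulmx1 mulmx_const natrD.
by apply/matrixP => i j; rewrite !mxE; case: (i == j); rewrite ?mulr1n ?mulr0n; field.
Qed.

Lemma hat_mul_sum :
  B1 *m B2 + B2 *m B1 = a%:R%:M + (2^-1 * (a%:R - 1)) *: (B1 + B2).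
Proof.
apply: (@scalerI _ _ 2); first by rewrite pnatr_eq0.
transitivity ((B1 + B2) *m (B1 + B2) - (B1 - B2) *m (B1 - B2)).
  rewrite !mulmxDl !mulmxDr !mulmxN !mulNmx.
  by apply/matrixP => i j; rewrite !mxE; ring.
rewrite hat_diff_sqr hat_sum mulmxBl mulmxBr mul1mx mulmx1 mulmx_const natrD.
by apply/matrixP => i j; rewrite !mxE; case: (i == j); rewrite ?mulr1n ?mulr0n; field.
Qed.

Lemma hat1_01 i j : B1 i j = 0 \/ B1 i j = 1.
Proof.
rewrite -(splitK i) -(splitK j) /B1 /hatA1.
case: (split i) => ?; case: (split j) => ?; rewrite /unsplit
  ?(block_mxEul, block_mxEur, block_mxEdl, block_mxEdr) ?mxE; auto.
exact: (scheme3_01 schemeA).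
Qed.

Lemma hat2E : B2 = B1^T.
Proof. by rewrite /B1 /B2 /hatA1 tr_block_mx !trmx0 trmx_const -A2E. Qed.

Lemma hat_diag i : B1 i i = 0.
Proof.
move: hat_sum => /matrixP/(_ i i); rewrite hat2E !mxE eqxx subrr -mulr2n => /eqP.
by rewrite mulrn_eq0 => /eqP.
Qed.

End Hats.

(** * Products, valencies and traces in the constructed scheme *)

Section SchemeQ.
Variables (F : numFieldType) (a : nat) (A1 A2 : 'M[F]_a).
Hypothesis A2E : A2 = A1^T.
Hypothesis schemeA : association_scheme [fset 1%:M; A1; A2]%fset.
Hypothesis rankA : #|` [fset 1%:M; A1; A2]%fset| = 3%N.

Let B1 := hatA1 A1.
Let B2 := hatA2 A2.
Let s := @sigma F a.
Let t := tau A1 A2.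
Let Q := schemeQ A1 A2.
Let k : F := 2^-1 * (a%:R - 1).

Local Notation columns :=
  [:: s 1%g; s (gx ^+ 2)%g; s gx; s (gx ^+ 3)%g;
      t (gx * gy)%g; t (gx ^+ 3 * gy)%g; t gy; t (gx ^+ 2 * gy)%g].

Lemma sigma_mul g h : s g *m s h = s (g * h)%g.
Proof. by rewrite /s /sigma tensmx_mul mul1mx perm_mxM. Qed.

Lemma sigma_tau g h : s g *m t h = t (g * h)%g.
Proof. by rewrite /s /sigma /t /tau mulmxDr !tensmx_mul !mul1mx -!perm_mxM mulgA. Qed.

(** In the second summand of [tau], [h] has to pass the twist [gx ^+ 2]. *)
Lemma tau_sigma g h : commute (gx ^+ 2)%g h -> t g *m s h = t (g * h)%g.
Proof.
move=> comm_h; rewrite /s /sigma /t /tau mulmxDl !tensmx_mul !mulmx1 -!perm_mxM.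
by rewrite -(mulgA g (gx ^+ 2)%g) comm_h mulgA.
Qed.

Let gx2K g : (g * gx ^+ 2 * gx ^+ 2 = g)%g.
Proof. by rewrite -(mulgA g) -expgD gx4 mulg1. Qed.

Lemma gx2_comm_gx i : commute (gx ^+ 2)%g (gx ^+ i)%g.
Proof. by rewrite /commute -!expgD addnC. Qed.

Lemma gx2_comm_gy : commute (gx ^+ 2)%g gy.
Proof.
rewrite /commute (dihedral_comm gyx) -[(3 * 2)%N]/(4 + 2)%N expgD gx4.
by rewrite mul1g.
Qed.

Lemma gx2_comm_refl i : commute (gx ^+ 2)%g (gx ^+ i * gy)%g.
Proof. exact: (commuteM (gx2_comm_gx i) gx2_comm_gy). Qed.

Lemma reflection_sqr i : ((gx ^+ i * gy) * (gx ^+ i * gy) = 1)%g.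
Proof.
rewrite (mulgA (gx ^+ i * gy)%g) -(mulgA (gx ^+ i)%g) (dihedral_comm gyx) (mulgA (gx ^+ i)%g).
rewrite -expgD -(mulgA _ gy gy) -[(gy * gy)%g]/(gy ^+ 2)%g gy2 mulg1.
by rewrite -[i in (i + _)%N]mul1n -mulnDl expgM gx4 expg1n.
Qed.

(** [gx * gy] fixes 0 and 2 and swaps 1 and 3, while [gx ^+ 3 * gy] does the reverse. In [tau_sqr]
    this relation brings the product back into the span of the scheme. *)
Lemma perm_mx_rel :
  perm_mx (gx * gy)%g + perm_mx (gx ^+ 3 * gy)%g = 1%:M + perm_mx (gx ^+ 2)%g :> 'M[F]_4.
Proof.
apply/matrixP => i j; rewrite !mxE !expgS expg0 mulg1 !(permM _ gy) !(permM gx) !gyE !gxE.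
rewrite -!val_eqE /=.
case: i => [[|[|[|[|//]]]] ?] /=; rewrite !inordK //= ?inordK //=;
  by case: j => [[|[|[|[|//]]]] ?]; rewrite /= ?addr0 ?add0r.
Qed.

Lemma tau_add g : t g + t (g * gx ^+ 2)%g = (B1 + B2) *t (perm_mx g + perm_mx (g * gx ^+ 2)%g).
Proof.
rewrite /t /tau gx2K tensmxDl !tensmxDr -!addrA.
by congr (_ + _); rewrite addrCA; congr (_ + _); rewrite addrC.
Qed.

(** As [g] is an involution commuting with [gx ^+ 2], the product is [B1 ^ 2 + B2 ^ 2] tensored with
    1 plus [B1 B2 + B2 B1] tensored with [gx ^+ 2]. The hat identities turn this into [a] times
    [sigma (gx ^+ 2)] plus [k (B1 + B2)] tensored with [1 + gx ^+ 2]. *)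
Lemma tau_sqr i : t (gx ^+ i * gy)%g *m t (gx ^+ i * gy)%g =
  a%:R *: s (gx ^+ 2)%g + k *: (t (gx * gy)%g + t (gx ^+ 3 * gy)%g).
Proof.
set g := (gx ^+ i * gy)%g.
have gg : (g * g = 1)%g by exact: reflection_sqr.
have gz : (gx ^+ 2 * g = g * gx ^+ 2)%g by exact: gx2_comm_refl.
have -> : (gx ^+ 3 * gy = gx * gy * gx ^+ 2)%g.
  by rewrite -(mulgA gx gy) -gx2_comm_gy (mulgA gx) -expgS.
rewrite tau_add.
have -> : (gx * gy * gx ^+ 2 = gx ^+ 3 * gy)%g.
  by rewrite -(mulgA gx gy) -gx2_comm_gy (mulgA gx) -expgS.
rewrite perm_mx_rel /t /tau -/B1 -/B2 mulmxDl !mulmxDr !tensmx_mul -!perm_mxM.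
rewrite -(mulgA g (gx ^+ 2)%g g) gz (mulgA g g (gx ^+ 2)%g) gg mul1g.
rewrite -(mulgA g (gx ^+ 2)%g) (mulgA (gx ^+ 2)%g g) gz gx2K gg perm_mx1.
transitivity ((B1 *m B1 + B2 *m B2) *t 1%:M +
    (B1 *m B2 + B2 *m B1) *t perm_mx (gx ^+ 2)%g : 'M[F]_((1 + a) * 4)).
  rewrite !tensmxDl -!addrA; congr (_ + _); rewrite addrA addrC; congr (_ + _).
rewrite (hat_sqr_sum A2E schemeA rankA) (hat_mul_sum A2E schemeA rankA).
rewrite /s /sigma !tensmxDl !tensmxDr !tensmxZl -(scalemx1 _ a%:R) tensmxZl -/B1 -/B2 -/k.
by apply/matrixP => i' j'; rewrite !mxE; ring.
Qed.

Let perm_mx_eq1 (g : 'S_4) p q : (perm_mx g : 'M[F]_4) p q = 1 -> g p = q.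
Proof. by rewrite !mxE; case: eqP => // _ /esym/eqP; rewrite oner_eq0. Qed.

Let perm_mx_app (g : 'S_4) p : (perm_mx g : 'M[F]_4) p (g p) = 1.
Proof. by rewrite !mxE eqxx. Qed.

(** Two positions that tell the matrices apart: the block at ([col0], [col0]) is the permutation
    matrix for [sigma] and zero for [tau], whose permutation matrix is the block at ([col0],
    [col1]). *)
Let col0 : 'I_(1 + a) := lshift a ord0.
Let col1 : 'I_(1 + a) := rshift 1 (Ordinal (scheme3_order_gt0 schemeA)).

Let sigma_entry g p q : s g (mxtens_index (col0, p)) (mxtens_index (col0, q)) = perm_mx g p q.
Proof. by rewrite tensmxE mxE eqxx mul1r. Qed.

Let tau_entry0 g p q : t g (mxtens_index (col0, p)) (mxtens_index (col0, q)) = 0.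
Proof. by rewrite mxE !tensmxE !block_mxEul !mxE !mul0r addr0. Qed.

Let tau_entry1 g p q : t g (mxtens_index (col0, p)) (mxtens_index (col1, q)) = perm_mx g p q.
Proof. by rewrite mxE !tensmxE !block_mxEur !mxE mul0r addr0 mul1r. Qed.

Lemma sigma_inj : injective s.
Proof.
move=> g h /matrixP E; apply/permP => p; apply: perm_mx_eq1.
by rewrite -sigma_entry E sigma_entry perm_mx_app.
Qed.

Lemma tau_inj : injective t.
Proof.
move=> g h /matrixP E; apply/permP => p; apply: perm_mx_eq1.
by rewrite -tau_entry1 E tau_entry1 perm_mx_app.
Qed.

Lemma sigma_neq_tau g h : s g != t h.
Proof.
apply/eqP => /matrixP/(_ (mxtens_index (col0, ord0)) (mxtens_index (col0, g ord0))).
by move/eqP; rewrite sigma_entry tau_entry0 perm_mx_app oner_eq0.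
Qed.

Lemma schemeQ_columns : Q =i columns.
Proof.
move=> M; rewrite -[columns]/(map s [:: 1; gx ^+ 2; gx; gx ^+ 3]%g ++
  map t [:: gx * gy; gx ^+ 3 * gy; gy; gx ^+ 2 * gy]%g) mem_cat in_fsetU.
by congr (_ || _); apply/imfsetP/mapP => -[g /= Hg ->]; exists g => //=;
  rewrite ?groupKE ?groupGDKE // in Hg *; rewrite -?groupKE -?groupGDKE.
Qed.

Lemma columns_uniq : uniq columns.
Proof.
rewrite -[columns]/(map s [:: 1; gx ^+ 2; gx; gx ^+ 3]%g ++
  map t [:: gx * gy; gx ^+ 3 * gy; gy; gx ^+ 2 * gy]%g) cat_uniq.
rewrite (map_inj_uniq sigma_inj) (map_inj_uniq tau_inj) groupK_uniq groupGDK_uniq.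
rewrite andbT; apply/hasPn => _ /mapP[h _ ->]; apply/negP => /mapP[g _] /eqP.
by rewrite eq_sym (negPf (sigma_neq_tau _ _)).
Qed.

(** Turns sums over the finite set into sums over the explicit list. *)
Lemma schemeQ_perm : perm_eq Q columns.
Proof. exact: (uniq_perm (fset_uniq _) columns_uniq schemeQ_columns). Qed.

Lemma sigma_tens p q g (v : 'M[F]_(1 + a, p)) (P : 'M[F]_(4, q)) :
  s g *m (v *t P) = v *t (perm_mx g *m P).
Proof. by rewrite /s /sigma tensmx_mul mul1mx. Qed.

(** Where [gx ^+ 2] acts as [e], [t g] acts as [B1 + e *: B2] on the left factor and as [g] on the
    right one. *)
Lemma tau_tens p q g (v : 'M[F]_(1 + a, p)) (P : 'M[F]_(4, q)) (e r : F) :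
    perm_mx (gx ^+ 2)%g *m P = e *: P -> B1 *m v + e *: (B2 *m v) = r *: v ->
  t g *m (v *t P) = r *: (v *t (perm_mx g *m P)).
Proof.
move=> zP Bv; rewrite /t /tau mulmxDl !tensmx_mul perm_mxM -mulmxA zP -scalemxAr.
by rewrite tensmxZr -tensmxZl -tensmxDl Bv tensmxZl.
Qed.

Lemma hat_sum_const p : (B1 + B2) *m (const_mx 1 : 'M[F]_(1 + a, p)) = a%:R *: const_mx 1.
Proof.
rewrite (hat_sum schemeA rankA) mulmxBl mul1mx mulmx_const.
by apply/matrixP => i j; rewrite !mxE natrD; ring.
Qed.

Let perm_const p (g : 'S_4) : perm_mx g *m (const_mx 1 : 'M[F]_(4, p)) = const_mx 1.
Proof. by rewrite -row_permE row_perm_const. Qed.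

(** Row sums are read from the action on the all-ones column, so whichever row [valency] picks has
    [d] ones. *)
Lemma valencyE n (M : 'M[F]_n) (d : nat) : (0 < n)%N ->
    (forall i j, M i j = 0 \/ M i j = 1) ->
    M *m (const_mx 1 : 'cV_n) = d%:R *: const_mx 1 ->
  valency M = d.
Proof.
move=> n_gt0 M01 /matrixP rowM; rewrite /valency.
case: pickP => [i _|/(_ (Ordinal n_gt0)) //].
apply/eqP; rewrite -(@eqr_nat F); apply/eqP.
move: (rowM i 0); rewrite !mxE mulr1 => <-.
rewrite -sum1_card natr_sum big_mkcond; apply: eq_bigr => j _.
rewrite [const_mx _ _ _]mxE mulr1 !inE.
by have [->|->] := M01 i j; rewrite ?eqxx // eq_sym oner_eq0.
Qed.

Let const_tens : (const_mx 1 : 'cV[F]_((1 + a) * 4)) =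
  (const_mx 1 : 'cV[F]_(1 + a)) *t (const_mx 1 : 'cV[F]_4).
Proof. by rewrite tensmx_const mulr1. Qed.

Lemma valency_sigma g : valency (s g) = 1%N.
Proof.
apply: valencyE => // [i j|]; last by rewrite const_tens (@sigma_tens 1 1) perm_const scale1r.
case: (mxtens_indexP i) => i1 i2; case: (mxtens_indexP j) => j1 j2.
rewrite tensmxE !mxE; case: (i1 == j1); case: (_ == j2); rewrite ?mulr1 ?mulr0; auto.
Qed.

Lemma valency_tau g : valency (t g) = a.
Proof.
apply: valencyE => // [i j|]; last first.
  rewrite const_tens (@tau_tens 1 1 _ _ _ 1 a%:R) ?perm_const ?scale1r //.
  by rewrite -mulmxDl hat_sum_const.
case: (mxtens_indexP i) => i1 i2; case: (mxtens_indexP j) => j1 j2.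
rewrite mxE !tensmxE -/B1 -/B2.
have : B1 i1 j1 + B2 i1 j1 = 1 - (i1 == j1)%:R.
  by have /matrixP/(_ i1 j1) := hat_sum schemeA rankA; rewrite !mxE.
have [|] : B2 i1 j1 = 0 \/ B2 i1 j1 = 1.
  by rewrite [B2](hat2E A2E) mxE; exact: (hat1_01 schemeA).
- move=> -> _; rewrite mul0r addr0.
  have [->|->] : B1 i1 j1 = 0 \/ B1 i1 j1 = 1 by exact: (hat1_01 schemeA).
    by left; rewrite mul0r.
  by rewrite mul1r !mxE; case: (_ == j2); auto.
- move=> -> E; rewrite mul1r.
  have [->|B11] : B1 i1 j1 = 0 \/ B1 i1 j1 = 1 by exact: (hat1_01 schemeA).
    by rewrite mul0r add0r !mxE; case: (_ == j2); auto.
  (* If both entries were 1, the entry of [B1 + B2 = J - I] would be 2, which is impossible in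
     characteristic zero. *)
  have /eqP : (1 + (i1 == j1))%:R = 0 :> F.
    by rewrite natrD -(subrr (1 - (i1 == j1)%:R)) -{1}E B11; ring.
  by rewrite pnatr_eq0.
Qed.

Lemma schemeQ_frobenius chi (m : nat) :
  frobenius_schur Q chi m = m%:R / (((1 + a) * 4)%:R * chi 1%:M) *
   (chi (s 1%g *m s 1%g) + chi (s (gx ^+ 2)%g *m s (gx ^+ 2)%g) + chi (s gx *m s gx)
     + chi (s (gx ^+ 3)%g *m s (gx ^+ 3)%g) +
    a%:R^-1 * (chi (t (gx * gy)%g *m t (gx * gy)%g) +
      chi (t (gx ^+ 3 * gy)%g *m t (gx ^+ 3 * gy)%g) + chi (t gy *m t gy)
      + chi (t (gx ^+ 2 * gy)%g *m t (gx ^+ 2 * gy)%g))).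
Proof.
rewrite /frobenius_schur (perm_big _ schemeQ_perm) /= !big_cons big_nil.
by rewrite !valency_sigma !valency_tau !invr1; congr (_ * _); ring.
Qed.

Lemma sigma1 : s 1%g = 1%:M.
Proof. by rewrite /s /sigma perm_mx1 tensmx1. Qed.

Lemma mxtrace_sigma g : \tr (s g) = (1 + a)%:R * \tr (perm_mx g : 'M[F]_4).
Proof. by rewrite mxtrace_tens mxtrace1. Qed.

Lemma mxtrace_tau g : \tr (t g) = 0.
Proof.
have tr0 (B : 'M[F]_(1 + a)) : (forall i, B i i = 0) -> \tr B = 0.
  by move=> B0; rewrite /mxtrace big1.
rewrite mxtraceD !mxtrace_tens !tr0 ?mul0r ?addr0 // => i.
  by rewrite -/B2 [B2](hat2E A2E) mxE (hat_diag A2E schemeA rankA).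
exact: (hat_diag A2E schemeA rankA).
Qed.

End SchemeQ.

(** * Representations on an eigenvector tensored with a permutation submodule *)

Section TensorRepresentation.
Variables (F : numFieldType) (a : nat) (A1 A2 : 'M[F]_a).
Hypothesis A2E : A2 = A1^T.
Hypothesis schemeA : association_scheme [fset 1%:M; A1; A2]%fset.
Hypothesis rankA : #|` [fset 1%:M; A1; A2]%fset| = 3%N.

Let B1 := hatA1 A1.
Let B2 := hatA2 A2.
Let s := @sigma F a.
Let t := tau A1 A2.
Let Q := schemeQ A1 A2.
Let k : F := 2^-1 * (a%:R - 1).

Variables (d : nat) (P : 'M[F]_(4, d)) (P' : 'M[F]_(d, 4)) (X Y : 'M[F]_d).
Variables (v : 'cV[F]_(1 + a)) (w : 'rV[F]_(1 + a)) (e r : F).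

(** The columns of [P] span a submodule on which [gx] and [gy] act by [X] and [Y], and [v] is an
    eigenvector of [B1 + e *: B2]; [P'] and [w] are left inverses of [P] and [v]. *)
Definition tensor_rep := compression (w *t P') (v *t P).
Definition tensor_char u := \tr (tensor_rep u).

Hypotheses (P'P : P' *m P = 1%:M) (wv : w *m v = 1%:M).
Hypotheses (xP : perm_mx gx *m P = P *m X) (yP : perm_mx gy *m P = P *m Y).
Hypothesis XX : X *m X = e%:M.
Hypothesis Bv : B1 *m v + e *: (B2 *m v) = r *: v.

Let WV : (w *t P') *m (v *t P) = 1%:M.
Proof. by rewrite tensmx_mul wv P'P tensmx1. Qed.

Let perm_mulP g h D E : perm_mx g *m P = P *m D -> perm_mx h *m P = P *m E ->
  perm_mx (g * h)%g *m P = P *m (D *m E).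
Proof. by move=> gP hP; rewrite perm_mxM -mulmxA hP mulmxA gP mulmxA. Qed.

Let zP : perm_mx (gx ^+ 2)%g *m P = P *m (e%:M).
Proof. by rewrite -XX expgS expg1; exact: perm_mulP. Qed.

Let zP' : perm_mx (gx ^+ 2)%g *m P = e *: P.
Proof. by rewrite zP mul_mx_scalar. Qed.

Let sV g D : perm_mx g *m P = P *m D ->
  s g *m (v *t P) = (v *t P) *m (1%:M *t D).
Proof. by move=> gP; rewrite sigma_tens gP tensmx_mul mulmx1. Qed.

Let tV g D : perm_mx g *m P = P *m D ->
  t g *m (v *t P) = (v *t P) *m (1%:M *t (r *: D)).
Proof.
by move=> gP; rewrite (tau_tens _ zP' Bv) gP tensmx_mul mulmx1 -scalemxAr tensmxZr.
Qed.

Lemma tensor_rep_sigma g D : perm_mx g *m P = P *m D ->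
  tensor_rep (s g) = 1%:M *t D.
Proof. by move=> gP; apply: compression_eq; [exact: WV | exact: sV]. Qed.

Lemma tensor_rep_tau g D : perm_mx g *m P = P *m D ->
  tensor_rep (t g) = 1%:M *t (r *: D).
Proof. by move=> gP; apply: compression_eq; [exact: WV | exact: tV]. Qed.

Let groupG_stable g : g \in groupG -> exists D, perm_mx g *m P = P *m D.
Proof.
have iterP h : (exists D, perm_mx h *m P = P *m D) ->
    forall i, exists D, perm_mx (h ^+ i)%g *m P = P *m D.
  move=> [D hP]; elim=> [|i [E hiP]].
    by exists 1%:M; rewrite expg0 perm_mx1 mul1mx mulmx1.
  by exists (D *m E); rewrite expgS; exact: perm_mulP.
move=> /(dihedral_elt gyx)[i [j ->]].
have [D xiP] := iterP gx (ex_intro _ _ xP) i.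
have [E yjP] := iterP gy (ex_intro _ _ yP) j.
by exists (D *m E); exact: perm_mulP.
Qed.

Lemma tensor_rep_repr : representation Q tensor_rep.
Proof.
apply: compression_repr WV _ => M; rewrite in_fsetU => /orP[] /imfsetP[g /= gG ->].
  have [|D gP] := @groupG_stable g; first by move: gG; rewrite inE => /andP[].
  by exists (1%:M *t D); exact: sV.
have [|D gP] := @groupG_stable g; first by move: gG; rewrite inE => /andP[].
by exists (1%:M *t (r *: D)); exact: tV.
Qed.

Let x3P : perm_mx (gx ^+ 3)%g *m P = P *m (e *: X).
Proof. by rewrite expgS (perm_mulP xP zP) mul_mx_scalar. Qed.

Let xyP : perm_mx (gx * gy)%g *m P = P *m (X *m Y).
Proof. exact: perm_mulP. Qed.

Let x2yP : perm_mx (gx ^+ 2 * gy)%g *m P = P *m (e *: Y).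
Proof. by rewrite (perm_mulP zP yP) mul_scalar_mx. Qed.

Let x3yP : perm_mx (gx ^+ 3 * gy)%g *m P = P *m (e *: (X *m Y)).
Proof. by rewrite (perm_mulP x3P yP) -scalemxAl. Qed.

Let id_P : perm_mx 1%g *m P = P *m 1%:M.
Proof. by rewrite perm_mx1 mul1mx mulmx1. Qed.

Let char_sigma g D : perm_mx g *m P = P *m D -> tensor_char (s g) = \tr D.
Proof.
move=> gP; rewrite /tensor_char (tensor_rep_sigma gP).
by rewrite mxtrace_tens mxtrace1 mul1r.
Qed.

Let char_tau g D : perm_mx g *m P = P *m D -> tensor_char (t g) = r * \tr D.
Proof.
move=> gP; rewrite /tensor_char (tensor_rep_tau gP).
by rewrite mxtrace_tens mxtrace1 mul1r mxtraceZ.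
Qed.

Lemma tensor_char_columns :
  [seq tensor_char M | M <- [:: s 1%g; s (gx ^+ 2)%g; s gx; s (gx ^+ 3)%g;
      t (gx * gy)%g; t (gx ^+ 3 * gy)%g; t gy; t (gx ^+ 2 * gy)%g]] =
  [:: d%:R; e * d%:R; \tr X; e * \tr X; r * \tr (X *m Y); r * (e * \tr (X *m Y));
      r * \tr Y; r * (e * \tr Y)].
Proof.
rewrite /= (char_sigma id_P) (char_sigma zP) (char_sigma xP) (char_sigma x3P).
rewrite (char_tau xyP) (char_tau x3yP) (char_tau yP) (char_tau x2yP).
by rewrite !mxtraceZ mxtrace1 mxtrace_scalar mulr_natr.
Qed.

Let charD u u' : tensor_char (u + u') = tensor_char u + tensor_char u'.
Proof. by rewrite /tensor_char /tensor_rep /compression mulmxDr mulmxDl mxtraceD. Qed.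

Let charZ c u : tensor_char (c *: u) = c * tensor_char u.
Proof. by rewrite /tensor_char /tensor_rep /compression -scalemxAr -scalemxAl mxtraceZ. Qed.

(** Two of the [sigma] columns square to the identity and two to [sigma (gx ^+ 2)]; the four [tau]
    columns share the square found in [tau_sqr]. *)
Lemma tensor_char_frobenius m :
  frobenius_schur Q tensor_char m = m%:R / (((1 + a) * 4)%:R * d%:R) *
    (2 * d%:R * (1 + e) + a%:R^-1 * (4 * (a%:R * (e * d%:R)
       + k * (r * (1 + e) * \tr (X *m Y))))).
Proof.
rewrite (schemeQ_frobenius A2E schemeA rankA) !sigma_mul.
have -> : (gx ^+ 3 * gx ^+ 3 = gx ^+ 2)%g.
  by rewrite -expgD -[(3 + 3)%N]/(4 + 2)%N expgD gx4 mul1g.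
rewrite mulg1 -!expgD -[(2 + 2)%N]/4%N gx4 -[(gx * gx)%g]/(gx ^+ 2)%g -(@sigma1 F a).
have sqr i : tensor_char (t (gx ^+ i * gy)%g *m t (gx ^+ i * gy)%g) =
    a%:R * (e * d%:R) + k * (r * (1 + e) * \tr (X *m Y)).
  rewrite (tau_sqr A2E schemeA rankA) charD !charZ charD.
  rewrite (char_sigma zP) (char_tau xyP) (char_tau x3yP).
  by rewrite mxtrace_scalar mxtraceZ -(mulr_natr e) /k; ring.
have := sqr 0; rewrite expg0 mul1g => ->; have := sqr 1%N; rewrite expg1 => ->.
rewrite !sqr (char_sigma id_P) (char_sigma zP) mxtrace1 mxtrace_scalar.
by rewrite -(mulr_natr e); congr (_ * (_ + _ * _)); ring.
Qed.

End TensorRepresentation.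

(** * Every irreducible character has one of the five rows *)

Section Completeness.
Variables (F : numClosedFieldType) (a : nat) (A1 A2 : 'M[F]_a).
Hypothesis A2E : A2 = A1^T.
Hypothesis schemeA : association_scheme [fset 1%:M; A1; A2]%fset.
Hypothesis rankA : #|` [fset 1%:M; A1; A2]%fset| = 3%N.

Let s := @sigma F a.
Let t := tau A1 A2.
Let Q := schemeQ A1 A2.
Let k : F := 2^-1 * (a%:R - 1).

Local Notation columns :=
  [:: s 1%g; s (gx ^+ 2)%g; s gx; s (gx ^+ 3)%g;
      t (gx * gy)%g; t (gx ^+ 3 * gy)%g; t gy; t (gx ^+ 2 * gy)%g].

Let colsE : Q =i columns := schemeQ_columns A1 A2.

Let mem_columns M : M \in columns -> M \in adjacency_algebra Q.
Proof. by rewrite -colsE; exact: mem_adjacency. Qed.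

(** Both characters are traces of maps linear on the algebra, which the columns span. *)
Lemma char_eq_columns chi psi : irreducible_character Q chi ->
    irreducible_character Q psi ->
    [seq chi M | M <- columns] = [seq psi M | M <- columns] ->
  {in adjacency_algebra Q, chi =1 psi}.
Proof.
move=> [m [rho [[rho_rep _ _] chiE]]] [m' [rho' [[rho'_rep _ _] psiE]]].
move=> /eq_in_map chi_psi u Au; rewrite chiE // psiE //.
move: u Au; apply: adjacency_ind => [|M|c u v Au Av trE trE'].
- by rewrite (repr0 rho_rep) (repr0 rho'_rep) !raddf0.
- by rewrite colsE => colM; rewrite -chiE -?psiE ?chi_psi ?mem_columns.
- rewrite !(reprD rho_rep, reprD rho'_rep, reprZ rho_rep, reprZ rho'_rep) ?memvZ //.
  by rewrite !mxtraceD !mxtraceZ trE trE'.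
Qed.

Let inC n : (n < 8)%N -> nth 0 columns n \in columns.
Proof. by move=> ltn8; apply: mem_nth. Qed.

(** * Relations between the images of two generators *)

Section Generators.
Variables (m : nat) (rho : 'M[F]_((1 + a) * 4) -> 'M[F]_m.+1).
Hypothesis rho_irr : irreducible_representation Q rho.

Let rho_rep : representation Q rho. Proof. by case: rho_irr. Qed.

(** The degree is written [m.+1] so that square matrices form a ring and powers such as [X ^+ 2] are
    available. *)
Let X := rho (s gx).
Let T := rho (t (gx * gy)%g).

Let rhoM u v : u \in columns -> v \in columns -> rho (u *m v) = rho u * rho v.
Proof. by case: rho_rep => _ H _ Cu Cv; rewrite H ?mem_columns. Qed.

Let rho1 : rho (s 1%g) = 1.
Proof. by case: rho_rep => _ _; rewrite /s sigma1. Qed.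

Let rhoX2 : rho (s (gx ^+ 2)%g) = X ^+ 2.
Proof. by rewrite expgS expg1 /s -sigma_mul (rhoM (inC (n := 2) isT) (inC (n := 2) isT)). Qed.

Let rhoX3 : rho (s (gx ^+ 3)%g) = X ^+ 3.
Proof.
by rewrite expgS /s -sigma_mul (rhoM (inC (n := 2) isT) (inC (n := 1) isT)) rhoX2 -exprS.
Qed.

Let X4 : X ^+ 4 = 1.
Proof.
rewrite exprS -rhoX3 -(rhoM (inC (n := 2) isT) (inC (n := 3) isT)) /s sigma_mul.
by rewrite -expgS gx4.
Qed.

Let rhoX3y : rho (t (gx ^+ 3 * gy)%g) = X ^+ 2 * T.
Proof.
rewrite -rhoX2 -(rhoM (inC (n := 1) isT) (inC (n := 4) isT)) /s /t sigma_tau.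
by rewrite (mulgA _ gx) -expgSr.
Qed.

Let rhoX2y : rho (t (gx ^+ 2 * gy)%g) = X * T.
Proof.
by rewrite -(rhoM (inC (n := 2) isT) (inC (n := 4) isT)) /s /t sigma_tau (mulgA gx gx).
Qed.

Let rhoy : rho (t gy) = X ^+ 3 * T.
Proof.
rewrite -rhoX3 -(rhoM (inC (n := 3) isT) (inC (n := 4) isT)) /s /t sigma_tau (mulgA _ gx) -expgSr.
by rewrite gx4 mul1g.
Qed.

Let TX : T * X = X ^+ 3 * T.
Proof.
rewrite -rhoy -(rhoM (inC (n := 4) isT) (inC (n := 2) isT)) /s /t tau_sigma; last first.
  by rewrite /commute -expgS -expgSr.
by rewrite -(mulgA gx gy) gyx (mulgA gx) -expgS gx4 mul1g.
Qed.

Let TT : T * T = a%:R *: X ^+ 2 + k *: (T + X ^+ 2 * T).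
Proof.
rewrite -(rhoM (inC (n := 4) isT) (inC (n := 4) isT)); have := tau_sqr A2E schemeA rankA 1.
rewrite expg1 -/t => ->.
have As : sigma F a (gx ^+ 2)%g \in adjacency_algebra Q by exact: mem_columns (inC (n := 1) isT).
have At : t (gx * gy)%g \in adjacency_algebra Q by exact: mem_columns (inC (n := 4) isT).
have At' : t (gx ^+ 3 * gy)%g \in adjacency_algebra Q by exact: mem_columns (inC (n := 5) isT).
rewrite (reprD rho_rep (memvZ _ As) (memvZ _ (memvD At At'))).
rewrite (reprZ rho_rep _ As) (reprZ rho_rep _ (memvD At At')).
by rewrite (reprD rho_rep At At') rhoX2 rhoX3y.
Qed.

(** Each column is sent to a monomial in [X] and [T]. *)
Let rho_ind (P : 'M[F]_m.+1 -> Prop) : P 1 -> P X -> P T ->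
  (forall C D, P C -> P D -> P (C * D)) -> {in Q, forall M, P (rho M)}.
Proof.
move=> P1 PX PT PM M; rewrite colsE !inE.
have PX2 : P (X ^+ 2) by rewrite expr2; exact: PM.
have PX3 : P (X ^+ 3) by rewrite exprS; exact: PM.
case/orP=> [/eqP->|]; first by rewrite rho1.
case/orP=> [/eqP->|]; first by rewrite rhoX2.
case/orP=> [/eqP->|]; first by [].
case/orP=> [/eqP->|]; first by rewrite rhoX3.
case/orP=> [/eqP->|]; first by [].
case/orP=> [/eqP->|]; first by rewrite rhoX3y; exact: PM.
case/orP=> [/eqP->|/eqP->]; first by rewrite rhoy; exact: PM.
by rewrite rhoX2y; exact: PM.
Qed.

Let comm_rho C : GRing.comm C X -> GRing.comm C T ->
  {in Q, forall M, C *m rho M = rho M *m C}.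
Proof.
move=> CX CT; apply: (rho_ind (P := fun D => GRing.comm C D)) => //; first exact: commr1.
by move=> D E CD CE; exact: commrM.
Qed.

Let TX2 : T * X ^+ 2 = X ^+ 2 * T.
Proof.
rewrite [in LHS]expr2 mulrA TX -mulrA TX mulrA -exprD -[(3 + 3)%N]/(4 + 2)%N.
by rewrite exprD X4 mul1r.
Qed.

Lemma irr_central_square : X ^+ 2 = 1 \/ X ^+ 2 = -1.
Proof.
apply: (schur_involution rho_irr); last by rewrite mulmxE -exprD X4.
by apply: comm_rho; [exact/commr_sym/commrX | rewrite /GRing.comm TX2].
Qed.

Let tr_columns chi : {in adjacency_algebra Q, forall u, chi u = \tr (rho u)} ->
  [seq chi M | M <- columns] = [:: m.+1%:R; \tr (X ^+ 2); \tr X; \tr (X ^+ 3);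
     \tr T; \tr (X ^+ 2 * T); \tr (X ^+ 3 * T); \tr (X * T)].
Proof.
move=> chiE; transitivity [seq \tr (rho M) | M <- columns].
  by apply/eq_in_map => M /mem_columns; exact: chiE.
by rewrite /= rho1 rhoX2 rhoX3 rhoX3y rhoy rhoX2y; congr (_ :: _); exact: mxtrace1.
Qed.

Lemma irr_char_commutative chi :
    {in adjacency_algebra Q, forall u, chi u = \tr (rho u)} -> X ^+ 2 = 1 ->
  exists c r, [/\ c = 1 \/ c = -1, r = a%:R \/ r = -1 &
    [seq chi M | M <- columns] = [:: 1; 1; c; c; r; r; c * r; c * r]].
Proof.
move=> chiE X2.
have X3 : X ^+ 3 = X by rewrite exprS X2 mulr1.
have XT : GRing.comm X T by rewrite /GRing.comm TX X3.
have [c cE XE] : exists2 c : F, c = 1 \/ c = -1 & X = c%:M.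
  have [||->|->] := schur_involution rho_irr (C := X).
  - exact: comm_rho.
  - by rewrite mulmxE -expr2.
  - by exists 1; auto.
  - by exists (-1); [auto | rewrite raddfN].
have [r rE TE] : exists2 r : F, r = a%:R \/ r = -1 & T = r%:M.
  (* Since [2 * k = a - 1], the relation for [T * T] becomes [T ^+ 2 = a + (a - 1) T], which factors
     as [(T - a) (T + 1) = 0]. *)
  have [||Ta|T1] := schur_mul0 rho_irr (C := T - a%:R%:M) (D := T + 1%:M).
  - have comm_scalar (C : 'M[F]_m.+1) : GRing.comm (a%:R%:M) C.
      by rewrite /GRing.comm -mulmxE scalar_mxC.
    by apply: comm_rho; apply/commr_sym/commrB => //; apply/commr_sym/comm_scalar.
  - rewrite mulmxE mulrDr mulrBl TT X2 mul1r -mulmxE mul_scalar_mx mulmx1 scalemx1.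
    rewrite -mulr2n -scaler_nat scalerA.
    have -> : k * 2 = a%:R - 1 by rewrite /k; field.
    by rewrite scalerBl scale1r; apply/matrixP => i j; rewrite !mxE; ring.
  - by exists a%:R; [auto | apply/eqP; rewrite -subr_eq0 Ta].
  - by exists (-1); [auto | apply/eqP; rewrite raddfN -addr_eq0 T1].
exists c, r; split=> //; rewrite (tr_columns chiE) X2 X3 mul1r XE TE -mulmxE -scalar_mxM.
have m1 : m.+1 = 1%N.
  apply: (irr_scalar_dim rho_irr); apply: (rho_ind (P := fun D => is_scalar_mx D)).
  - exact: scalar_mx_is_scalar.
  - by rewrite XE scalar_mx_is_scalar.
  - by rewrite TE scalar_mx_is_scalar.
  - move=> C D /is_scalar_mxP[x ->] /is_scalar_mxP[y ->].
    by rewrite -mulmxE -scalar_mxM scalar_mx_is_scalar.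
by rewrite !mxtrace_scalar m1 !mulr1n.
Qed.

Lemma irr_char_noncommutative chi :
    {in adjacency_algebra Q, forall u, chi u = \tr (rho u)} -> X ^+ 2 = -1 ->
  [seq chi M | M <- columns] = [:: 2; -2; 0; 0; 0; 0; 0; 0].
Proof.
move=> chiE X2.
have a_neq0 : a%:R != 0 :> F by rewrite pnatr_eq0 -lt0n (scheme3_order_gt0 schemeA).
have X3 : X ^+ 3 = - X by rewrite exprS X2 mulrN1.
have TXN : T * X = - (X * T) by rewrite TX X3 mulNr.
have TTa : T * T = (- a%:R)%:M.
  by rewrite TT X2 mulN1r subrr scaler0 addr0 scalerN -scaleNr; exact: scalemx1.
have T_neq0 : T != 0.
  apply/eqP => T0; have /matrixP/(_ 0 0) := TTa; rewrite T0 mulr0 !mxE mulr1n.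
  by move/esym/eqP; rewrite oppr_eq0 (negPf a_neq0).
have eq_opp0 (C : 'M[F]_m.+1) : C = - C -> C = 0.
  by move/eqP; rewrite -addr_eq0 -mulr2n -scaler_nat scaler_eq0 pnatr_eq0 => /eqP.
(* Commuting would give [X * T = 0], and then [T = - X ^+ 2 * T] would vanish. *)
have noncomm : ~ GRing.comm X T.
  rewrite /GRing.comm TXN => /eq_opp0 XT0; case/eqP: T_neq0; apply: oppr_inj.
  by rewrite oppr0 -mulN1r -X2 expr2 -mulrA XT0 mulr0.
have tr0 (x : F) : x = - x -> x = 0.
  by move/eqP; rewrite -addr_eq0 -mulr2n -mulr_natl mulf_eq0 pnatr_eq0 => /eqP.
(* By cyclicity of the trace, [\tr (T * X * T)] is both [-a] and [a] times [\tr X]. The same device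
   with [X * T * X] gives [\tr T = 0]. *)
have trX : \tr X = 0.
  apply: (mulfI (_ : - a%:R != 0)); first by rewrite oppr_eq0.
  rewrite mulr0; apply: tr0.
  have : \tr (T * X * T) = \tr (T * T * X).
    by rewrite -!mulmxE [LHS]mxtrace_mulC mulmxA.
  rewrite TXN mulNr -(mulrA X) TTa -!mulmxE mul_mx_scalar mul_scalar_mx.
  by rewrite raddfN /= mxtraceZ => {1}<-.
have trT : \tr T = 0.
  apply: tr0; have : \tr (X * T * X) = \tr (X * X * T).
    by rewrite -!mulmxE [LHS]mxtrace_mulC mulmxA.
  by rewrite -mulrA TXN mulrN mulrA -expr2 X2 mulN1r opprK raddfN.
have trXT : \tr (X * T) = 0.
  by apply: tr0; rewrite -raddfN -TXN -!mulmxE mxtrace_mulC.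
have m2 : m.+1 = 2.
  (* Degree 1 is excluded because 1 by 1 matrices commute; for the upper bound a non-zero submodule
     of dimension at most 2 is built. *)
  apply/eqP; rewrite eqn_leq; apply/andP; split; last first.
    case: (m) X T noncomm => // X' T' []; rewrite /GRing.comm -!mulmxE.
    by rewrite [X']mx11_scalar scalar_mxC.
  (* Since [(X - 'i) (X + 'i) = X ^+ 2 + 1 = 0], a non-zero column of [X + 'i] is an eigenvector of
     [X] for ['i]; one exists because [X] is not the scalar [- 'i]. *)
  have [j nzj] : exists j, col j (X + 'i%:M) != 0.
    case: (pickP (fun j => col j (X + 'i%:M) != 0)) => [j nzj|Xi0]; first by exists j.
    case: noncomm; have -> : X = (- 'i)%:M; last by rewrite /GRing.comm -mulmxE scalar_mxC.
    apply/eqP; rewrite raddfN -addr_eq0; apply/eqP/matrixP => p q.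
    by have /negbFE/eqP/matrixP/(_ p 0) := Xi0 q; rewrite !mxE.
  pose w := col j (X + 'i%:M).
  have Xw : X *m w = 'i *: w.
    rewrite /w !colE mulmxA scalemxAl; congr (_ *m _).
    rewrite mulmxDr mulmxE -expr2 X2 -mulmxE mul_mx_scalar scalerDr addrC; congr (_ + _).
    by rewrite -scalemx1 scalerA -expr2 sqrCi scaleN1r.
  (* [X] acts on [T *m w] by [- 'i], and [T] sends it to a multiple of [w], so the span is a
     submodule. *)
  pose U := <<[:: w; T *m w]>>%VS.
  apply: leq_trans (_ : \dim U <= 2)%N; last exact: dim_span.
  have Uw : w \in U by rewrite memv_span ?inE ?eqxx.
  have UTw : T *m w \in U by rewrite memv_span ?inE ?eqxx ?orbT.
  apply: (irr_dim_le rho_irr).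
    by apply: contra nzj => /eqP U0; move: Uw; rewrite U0 memv0.
  have stableU (C : 'M[F]_m.+1) : C *m w \in U -> C *m (T *m w) \in U ->
      forall u, u \in U -> C *m u \in U.
    move=> Cw CTw u; rewrite {1}/U span_cons span_seq1.
    case/memv_addP=> _ /vlineP[x ->] [_ /vlineP[y ->] ->].
    by rewrite mulmxDr -!scalemxAr memvD ?memvZ.
  apply: (rho_ind (P := fun C => forall u, u \in U -> C *m u \in U)).
  - by move=> u; rewrite mul1mx.
  - apply: stableU; first by rewrite Xw memvZ.
    have -> : X *m (T *m w) = - (T *m (X *m w)).
      by rewrite !mulmxA !mulmxE TXN mulNmx opprK.
    by rewrite Xw -scalemxAr memvN memvZ.
  - by apply: stableU => //; rewrite mulmxA mulmxE TTa mul_scalar_mx memvZ.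
  - by move=> C D CU DU u Uu; rewrite -mulmxA CU ?DU.
rewrite (tr_columns chiE) X2 X3 mulN1r mulNr !raddfN /= trX trT trXT !oppr0.
by rewrite [\tr _](mxtrace1 F m.+1) m2.
Qed.

End Generators.

Definition character_rows : seq (seq F) := let b : F := a%:R in
  [:: [:: 1;  1;  1;  1;  b;  b;  b;  b];
      [:: 1;  1; -1; -1;  b;  b; -b; -b];
      [:: 1;  1;  1;  1; -1; -1; -1; -1];
      [:: 1;  1; -1; -1; -1; -1;  1;  1];
      [:: 2; -2;  0;  0;  0;  0;  0;  0]].

Lemma irr_char_columns chi : irreducible_character Q chi ->
  [seq chi M | M <- columns] \in character_rows.
Proof.
move=> [[|m] [rho [rho_irr chiE]]]; first by case: rho_irr.
have [X2|X2] := irr_central_square rho_irr.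
  have [c [r [cE rE ->]]] := irr_char_commutative rho_irr chiE X2.
  by case: cE rE => -> [] ->; rewrite ?(mul1r, mulN1r, opprK) !inE eqxx ?orbT.
by rewrite (irr_char_noncommutative rho_irr chiE X2) !inE eqxx !orbT.
Qed.

End Completeness.

(** * Simple modules of dimension 1 and 2 *)

Section Simplicity.
Variables (F : numFieldType) (N : nat) (S : {fset 'M[F]_N}).

Lemma irr_dim1 (rho : 'M[F]_N -> 'M[F]_1) :
  representation S rho -> irreducible_representation S rho.
Proof.
move=> rho_rep; split=> // U _.
have [->|nzU] := eqVneq U 0%VS; [by left | right].
apply/eqP; rewrite eqEdim subvf dimvf dim_matrix /=.
by rewrite lt0n dimv_eq0.
Qed.

(** [quarter_turn] and [swap] are the actions of [gx] and [gy] on the two columns of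
    [odd_vectors]. *)
Definition quarter_turn : 'M[F]_2 := mx_of_rows 2 [:: [:: 0; 1]; [:: -1; 0]].
Definition swap : 'M[F]_2 := mx_of_rows 2 [:: [:: 0; 1]; [:: 1; 0]].

Lemma quarter_turn_sqr : quarter_turn *m quarter_turn = (-1)%:M.
Proof.
apply/matrixP => i j; rewrite !mxE !big_ord_recl big_ord0 !mxE /=.
by case: i => [[|[|//]] ?]; case: j => [[|[|//]] ?]; rewrite /=; ring.
Qed.

Lemma mxtrace_quarter_turn : \tr quarter_turn = 0.
Proof. by rewrite /mxtrace !big_ord_recl big_ord0 !mxE /=; ring. Qed.

Lemma mxtrace_swap : \tr swap = 0.
Proof. by rewrite /mxtrace !big_ord_recl big_ord0 !mxE /=; ring. Qed.

Lemma mxtrace_turn_swap : \tr (quarter_turn *m swap) = 0.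
Proof. by rewrite /mxtrace !(big_ord_recl, big_ord0, mxE) /=; ring. Qed.

(* swap + quarter_turn and swap - quarter_turn are twice the matrix units E_01 and E_10. *)
Lemma turn_swap_simple (U : {vspace 'cV[F]_2}) :
    (forall u, u \in U -> quarter_turn *m u \in U) ->
    (forall u, u \in U -> swap *m u \in U) ->
  U = 0%VS \/ U = fullv.
Proof.
move=> UX UY; have [->|nzU] := eqVneq U 0%VS; [by left | right].
pose e0 : 'cV[F]_2 := delta_mx 0 0; pose e1 : 'cV[F]_2 := delta_mx 1 0.
have vecE (u : 'cV[F]_2) : u = u 0 0 *: e0 + u 1 0 *: e1.
  apply/matrixP => i j; rewrite ord1 !mxE.
  by case: i => [[|[|//]] ?]; rewrite /= ?(mulr1, mulr0, addr0, add0r);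
    congr (u _ _); apply: val_inj.
have swap0 : swap *m e0 = e1.
  by rewrite -colE; apply/matrixP => i j; rewrite ord1 !mxE; case: i => [[|[|//]] ?].
have swap1 : swap *m e1 = e0.
  by rewrite -colE; apply/matrixP => i j; rewrite ord1 !mxE; case: i => [[|[|//]] ?].
have turn0 : quarter_turn *m e0 = - e1.
  by rewrite -colE; apply/matrixP => i j; rewrite ord1 !mxE;
    case: i => [[|[|//]] ?]; rewrite /= ?oppr0.
have turn1 : quarter_turn *m e1 = e0.
  by rewrite -colE; apply/matrixP => i j; rewrite ord1 !mxE; case: i => [[|[|//]] ?].
have two_neq0 : 2 != 0 :> F by rewrite pnatr_eq0.
have UZ c u : c != 0 -> c *: u \in U -> u \in U.
  by move=> c0 /(memvZ c^-1); rewrite scalerA mulVf ?scale1r.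
suff [Ue0 Ue1] : e0 \in U /\ e1 \in U.
  apply/eqP; rewrite eqEsubv subvf; apply/subvP => u _.
  by rewrite [u]vecE memvD ?memvZ.
have := memv_pick U; set u := vpick U => Uu.
have nzu : u != 0 by rewrite vpick0.
have E01 : u 1 0 *: e0 \in U.
  apply: (UZ 2) => //; have := memvD (UY u Uu) (UX u Uu).
  rewrite [u]vecE !mulmxDr -!scalemxAr swap0 swap1 turn0 turn1 -vecE.
  rewrite scalerN addrACA subrr add0r -scalerDl -mulr2n.
  by rewrite scalerA mulr_natl.
have E10 : u 0 0 *: e1 \in U.
  apply: (UZ 2) => //; have := memvB (UY u Uu) (UX u Uu).
  rewrite [u]vecE !mulmxDr -!scalemxAr swap0 swap1 turn0 turn1 -vecE.
  rewrite opprD addrACA subrr addr0 scalerN opprK -scalerDl -mulr2n.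
  by rewrite scalerA mulr_natl.
(* A non-zero coordinate of [u] puts one basis vector into [U], and [swap] supplies the other. *)
have [u1|u1] := eqVneq (u 1 0) 0; last first.
  by have Ue0 := UZ _ _ u1 E01; split=> //; rewrite -swap0 UY.
have u0 : u 0 0 != 0.
  by apply: contra nzu => /eqP u0; rewrite [u]vecE u0 u1 !scale0r addr0.
by have Ue1 := UZ _ _ u0 E10; split=> //; rewrite -swap1 UY.
Qed.

End Simplicity.

(** * Submodules of the permutation module of dimension 4 *)

Section PermutationModules.
Variable F : numFieldType.

(** The all-ones vector for [c = 1] and the alternating one for [c = -1]; [gx] and [gy] both act on
    it by [c]. *)
Definition sign_vector (c : F) : 'cV[F]_4 := \col_i c ^+ i.

(* Columns e_0 - e_2 and e_1 - e_3, spanning the (-1)-eigenspace of gx ^+ 2. *)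
Definition odd_vectors : 'M[F]_(4, 2) :=
  \matrix_(i, j) ((i == j :> nat)%:R - (i == j + 2 :> nat)%N%:R).

Variable c : F.
Hypothesis cc : c * c = 1.

Lemma sign_vector_linv : (delta_mx 0 0 : 'rV_4) *m sign_vector c = 1%:M.
Proof. by rewrite -rowE; apply/matrixP => i j; rewrite !ord1 !mxE expr0. Qed.

Lemma sign_vector_gx : perm_mx gx *m sign_vector c = sign_vector c *m c%:M.
Proof.
rewrite -row_permE mul_mx_scalar; apply/matrixP => i j; rewrite !mxE gxE.
case: i => [[|[|[|[|//]]]] ?]; rewrite /= inordK //= ?expr0 ?expr1 ?mulr1 // -?exprS //.
by rewrite !exprS expr0 mulr1 cc mulr1 cc.
Qed.

Lemma sign_vector_gy : perm_mx gy *m sign_vector c = sign_vector c *m c%:M.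
Proof.
rewrite -row_permE mul_mx_scalar; apply/matrixP => i j; rewrite !mxE gyE.
by case: i => [[|[|[|[|//]]]] ?]; rewrite /= inordK //= !exprS ?expr0 ?mulr1 ?cc ?mulr1 ?cc.
Qed.

Lemma odd_vectors_linv : (pid_mx 2 : 'M[F]_(2, 4)) *m odd_vectors = 1%:M.
Proof.
apply/matrixP => i j; rewrite !mxE !big_ord_recl big_ord0 !mxE /=.
by case: i => [[|[|//]] ?]; case: j => [[|[|//]] ?]; rewrite /=; ring.
Qed.

Lemma odd_vectors_gx : perm_mx gx *m odd_vectors = odd_vectors *m quarter_turn F.
Proof.
rewrite -row_permE; apply/matrixP => i j; rewrite !mxE gxE !big_ord_recl big_ord0 !mxE /=.
case: i => [[|[|[|[|//]]]] ?]; rewrite /= inordK //=;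
  by case: j => [[|[|//]] ?]; rewrite /=; ring.
Qed.

Lemma odd_vectors_gy : perm_mx gy *m odd_vectors = odd_vectors *m swap F.
Proof.
rewrite -row_permE; apply/matrixP => i j; rewrite !mxE gyE !big_ord_recl big_ord0 !mxE /=.
case: i => [[|[|[|[|//]]]] ?]; rewrite /= inordK //=;
  by case: j => [[|[|//]] ?]; rewrite /=; ring.
Qed.

End PermutationModules.

(** * Construction of the five characters *)

Section Characters.
Variables (F : numClosedFieldType) (a : nat) (A1 A2 : 'M[F]_a).
Hypothesis A2E : A2 = A1^T.
Hypothesis schemeA : association_scheme [fset 1%:M; A1; A2]%fset.
Hypothesis rankA : #|` [fset 1%:M; A1; A2]%fset| = 3%N.

Let B1 := hatA1 A1.
Let B2 := hatA2 A2.
Let s := @sigma F a.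
Let t := tau A1 A2.
Let Q := schemeQ A1 A2.

Local Notation columns :=
  [:: s 1%g; s (gx ^+ 2)%g; s gx; s (gx ^+ 3)%g;
      t (gx * gy)%g; t (gx ^+ 3 * gy)%g; t gy; t (gx ^+ 2 * gy)%g].

(** The eigenvectors below are normalised by [v 0 0 = 1], so this one row is a left inverse of
    each. *)
Let w : 'rV[F]_(1 + a) := delta_mx 0 0.

Let w_linv (v : 'cV[F]_(1 + a)) : v 0 0 = 1 -> w *m v = 1%:M.
Proof. by move=> v0; rewrite -rowE; apply/matrixP => i j; rewrite !ord1 !mxE v0. Qed.

Let a_gt0 : (0 < a)%N := scheme3_order_gt0 schemeA.
Let a_neq0 : a%:R != 0 :> F. Proof. by rewrite pnatr_eq0 -lt0n. Qed.
Let n_neq0 : 1 + a%:R != 0 :> F. Proof. by rewrite nat1r pnatr_eq0. Qed.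

(** * Characters of degree 1 *)

Section LinearCharacter.
Variables (c r : F) (v : 'cV[F]_(1 + a)).
Hypotheses (cc : c * c = 1) (v0 : v 0 0 = 1) (Bv : (B1 + B2) *m v = r *: v).

Definition linear_char := tensor_char (sign_vector c) (delta_mx 0 0) v w.

Let Bv1 : B1 *m v + 1 *: (B2 *m v) = r *: v.
Proof. by rewrite scale1r -mulmxDl. Qed.

Let XX : (c%:M : 'M_1) *m c%:M = 1%:M. Proof. by rewrite -scalar_mxM cc. Qed.

Lemma linear_char_irr : irreducible_character Q linear_char.
Proof.
exists (1 * 1)%N, (tensor_rep (sign_vector c) (delta_mx 0 0) v w).
split=> //; apply: irr_dim1.
exact: (tensor_rep_repr (sign_vector_linv c) (w_linv v0) (sign_vector_gx cc)
  (sign_vector_gy cc) XX Bv1).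
Qed.

Lemma linear_char_columns :
  [seq linear_char M | M <- columns] = [:: 1; 1; c; c; r; r; r * c; r * c].
Proof.
rewrite (tensor_char_columns (sign_vector_linv c) (w_linv v0) (sign_vector_gx cc)
  (sign_vector_gy cc) XX Bv1).
by rewrite -scalar_mxM cc !mxtrace_scalar !mul1r !mulr1.
Qed.

Lemma linear_char_frobenius m :
  frobenius_schur Q linear_char m =
    m%:R / ((1 + a)%:R * 4) * (4 + a%:R^-1 * (4 * (a%:R + (a%:R - 1) * r))).
Proof.
rewrite (tensor_char_frobenius A2E schemeA rankA (sign_vector_linv c) (w_linv v0)
  (sign_vector_gx cc) (sign_vector_gy cc) XX Bv1).
rewrite -scalar_mxM cc mxtrace1 natrM mulr1.
by congr (_ * (_ + _ * (_ * _))); field.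
Qed.

End LinearCharacter.

(** For [r = a] the last factor of [linear_char_frobenius] is [4 * (1 + a)], which the denominator
    cancels. *)
Lemma linear_char_frobenius_valency (c : F) (v : 'cV_(1 + a)) : c * c = 1 -> v 0 0 = 1 ->
  (B1 + B2) *m v = a%:R *: v -> frobenius_schur Q (linear_char c v) 1 = 1.
Proof.
move=> cc v0 Bv; rewrite (linear_char_frobenius cc v0 Bv) natrD.
by field; rewrite a_neq0 n_neq0.
Qed.

(** For [r = -1] the last factor is [4 * (1 + a) / a], and the multiplicity [a] compensates. *)
Lemma linear_char_frobenius_sum0 (c : F) (v : 'cV_(1 + a)) : c * c = 1 -> v 0 0 = 1 ->
  (B1 + B2) *m v = -1 *: v -> frobenius_schur Q (linear_char c v) a = 1.
Proof.
move=> cc v0 Bv; rewrite (linear_char_frobenius cc v0 Bv) natrD.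
by field; rewrite a_neq0 n_neq0.
Qed.

Let v1 : 'cV[F]_(1 + a) := const_mx 1.
(** A column of sum zero, hence an eigenvector of J - I for -1; [ord_max] is not 0 because [a] is
    positive. *)
Let v2 : 'cV[F]_(1 + a) := delta_mx 0 0 - delta_mx ord_max 0.

Let Bv1 : (B1 + B2) *m v1 = a%:R *: v1.
Proof. exact: hat_sum_const. Qed.

Let v10 : v1 0 0 = 1. Proof. by rewrite mxE. Qed.

Let v20 : v2 0 0 = 1.
Proof.
have nz : (0 == ord_max :> 'I_(1 + a)) = false.
  by apply/negbTE; rewrite -val_eqE /= eq_sym -lt0n.
by rewrite !mxE !eqxx nz subr0.
Qed.

Let Bv2 : (B1 + B2) *m v2 = -1 *: v2.
Proof.
rewrite (hat_sum schemeA rankA) mulmxBl mul1mx mulmxBr -!colE !col_const subrr sub0r.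
by rewrite scaleN1r.
Qed.

(* An eigenvalue of B1 - B2, since (B1 - B2)^2 = -a; the column v5 below is an
   eigenvector by the same identity. *)
Let mu : F := sqrtC (- a%:R).
Let mu2 : mu * mu = - a%:R. Proof. by rewrite -expr2 sqrtCK. Qed.
Let mu_neq0 : mu != 0. Proof. by rewrite sqrtC_eq0 oppr_eq0. Qed.

Let v5 : 'cV[F]_(1 + a) := mu^-1 *: ((B1 - B2 + mu%:M) *m delta_mx 0 0).

Let v50 : v5 0 0 = 1.
Proof.
have B1_0 : B1 0 0 = 0 by exact: hat_diag A2E schemeA rankA 0.
have B2_0 : B2 0 0 = 0 by rewrite /B2 (hat2E A2E) mxE.
have E0 : (B1 - B2 + mu%:M) 0 0 = mu.
  rewrite mxE [(B1 - B2) _ _]mxE B1_0 [(- B2) _ _]mxE B2_0 subrr add0r.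
  by rewrite mxE eqxx mulr1n.
by rewrite /v5 -colE mxE [col _ _ _ _]mxE E0 mulVf.
Qed.

Let Bv5 : B1 *m v5 + -1 *: (B2 *m v5) = mu *: v5.
Proof.
rewrite scaleN1r -mulNmx -mulmxDl /v5 -scalemxAr scalerA mulrC -scalerA; congr (_ *: _).
rewrite mulmxA mulmxDr (hat_diff_sqr A2E schemeA rankA) -mul_scalar_mx mulmxA.
by rewrite mulmxDr -scalar_mxM mu2 raddfN addrC scalar_mxC.
Qed.

Definition quaternion_char := tensor_char (odd_vectors F) (pid_mx 2) v5 w.

Lemma quaternion_char_irr : irreducible_character Q quaternion_char.
Proof.
have P'P := odd_vectors_linv F; have wv := w_linv v50.
have xP := odd_vectors_gx F; have yP := odd_vectors_gy F; have XX := quarter_turn_sqr F.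
exists (1 * 2)%N, (tensor_rep (odd_vectors F) (pid_mx 2) v5 w).
have rep := tensor_rep_repr P'P wv xP yP XX Bv5.
split=> //; split=> // U stU.
have tens2 (D : 'M[F]_2) : (1%:M : 'M_1) *t D = D :> 'M_2.
  by rewrite tens_scalar1mx; apply/matrixP => i j; rewrite castmxE; congr (D _ _); apply: val_inj.
have col_in n : (n < 8)%N -> nth 0 columns n \in adjacency_algebra Q.
  by move=> lt8; apply: mem_adjacency; rewrite schemeQ_columns; apply: mem_nth.
(* Columns 2 and 6, [sigma gx] and [tau gy], act as [quarter_turn] and [mu *: swap], with [mu]
   invertible. *)
apply: (@turn_swap_simple _ U) => u Uu.
  have := stU _ _ (col_in 2 isT) Uu.
  by rewrite [X in X *m _](tensor_rep_sigma P'P wv xP) tens2.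
have := stU _ _ (col_in 6 isT) Uu.
rewrite [X in X *m _](tensor_rep_tau P'P wv xP XX Bv5 yP) tens2 -scalemxAl.
by move/(memvZ mu^-1); rewrite scalerA mulVf // scale1r.
Qed.

Lemma quaternion_char_columns :
  [seq quaternion_char M | M <- columns] = [:: 2; -2; 0; 0; 0; 0; 0; 0].
Proof.
rewrite (tensor_char_columns (odd_vectors_linv F) (w_linv v50) (odd_vectors_gx F)
  (odd_vectors_gy F) (quarter_turn_sqr F) Bv5).
rewrite mxtrace_quarter_turn mxtrace_turn_swap mxtrace_swap !mulr0.
by rewrite mulN1r.
Qed.

(** For [e = -1] the terms in [1 + e] vanish and the last factor is -8: the sign comes from the
    squares of the four [tau] columns. *)
Lemma quaternion_char_frobenius : frobenius_schur Q quaternion_char (1 + a) = -1.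
Proof.
rewrite (tensor_char_frobenius A2E schemeA rankA (odd_vectors_linv F) (w_linv v50)
  (odd_vectors_gx F) (odd_vectors_gy F) (quarter_turn_sqr F) Bv5).
rewrite mxtrace_turn_swap natrM natrD.
by field; rewrite a_neq0 n_neq0.
Qed.

Definition scheme_char (i : 'I_5) : 'M[F]_((1 + a) * 4) -> F :=
  nth (fun=> 0) [:: linear_char 1 v1; linear_char (-1) v1; linear_char 1 v2;
                    linear_char (-1) v2; quaternion_char] i.

Let scheme_char_irr i : irreducible_character Q (scheme_char i).
Proof.
have NN : -1 * -1 = 1 :> F by rewrite mulrNN mulr1.
case: i => [[|[|[|[|[|//]]]]] ?]; rewrite /scheme_char /=.
- exact: linear_char_irr (mulr1 1) v10 Bv1.
- exact: linear_char_irr NN v10 Bv1.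
- exact: linear_char_irr (mulr1 1) v20 Bv2.
- exact: linear_char_irr NN v20 Bv2.
- exact: quaternion_char_irr.
Qed.

Lemma scheme_char_columns i :
  [seq scheme_char i M | M <- columns] = nth [::] (character_rows F a) i.
Proof.
have NN : -1 * -1 = 1 :> F by rewrite mulrNN mulr1.
case: i => [[|[|[|[|[|//]]]]] ?]; rewrite /scheme_char [nth _ _ _]/=
  [nth _ (character_rows _ _) _]/=.
- by rewrite (linear_char_columns (mulr1 1) v10 Bv1) mulr1.
- by rewrite (linear_char_columns NN v10 Bv1) mulrN1.
- by rewrite (linear_char_columns (mulr1 1) v20 Bv2) mulr1.
- by rewrite (linear_char_columns NN v20 Bv2) mulrNN mulr1.
- exact: quaternion_char_columns.
Qed.

(** Separates the five characters; in characteristic zero 1 differs from -1 and 2, and [a] from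
    -1. *)
Lemma character_rows_uniq : uniq (character_rows F a).
Proof.
have e1 : (1 == -1 :> F) = false by rewrite -subr_eq0 opprK -mulr2n pnatr_eq0.
have e2 : (a%:R == -1 :> F) = false by rewrite -subr_eq0 opprK natr1 pnatr_eq0.
have e3 : (1 == 2 :> F) = false by rewrite (eqr_nat _ 1 2).
by rewrite /= !inE !eqseq_cons e1 e2 e3 ?(eq_sym (-1) 1) e1 !andbF.
Qed.

Lemma scheme_char_irreducible : irreducible_characters Q scheme_char.
Proof.
split=> [|i j eq_ij|chi chi_irr]; first exact: scheme_char_irr.
- apply/val_inj/eqP; rewrite -(nth_uniq [::] _ _ character_rows_uniq) ?ltn_ord //.
  rewrite -!scheme_char_columns; apply/eqP/eq_in_map => M colM; apply: eq_ij.
  by apply: mem_adjacency; rewrite schemeQ_columns.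
- have /(nthP [::])[i lti rowE] := irr_char_columns A2E schemeA rankA chi_irr.
  exists (Ordinal lti); apply: char_eq_columns => //.
  by rewrite scheme_char_columns -rowE.
Qed.

Definition scheme_mult (i : 'I_5) : nat := nth 0 [:: 1; 1; a; a; 1 + a]%N i.

(** Both sides are linear on the algebra, so columns suffice: the standard trace is [4 * (1 + a)] on
    the identity and 0 on the others, whose diagonals are zero. *)
Lemma scheme_char_multiplicities : multiplicities Q scheme_char scheme_mult.
Proof.
have psiD i c : {in adjacency_algebra Q &, forall u v,
    scheme_char i (c *: u + v) = c * scheme_char i u + scheme_char i v}.
  have [m [rho [[[linr _ _] _ _] chiE]]] := scheme_char_irr i.
  by move=> u v Au Av; rewrite !chiE ?memvD ?memvZ // linr // mxtraceD mxtraceZ.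
have psi0 i : scheme_char i 0 = 0.
  have := psiD i (-1) 0 0 (mem0v _) (mem0v _).
  by rewrite scaler0 addr0 mulN1r addNr.
apply: adjacency_ind => [|M|c u v Au Av trE trE'].
- by rewrite raddf0 big1 // => i _; rewrite psi0 mulr0.
- rewrite schemeQ_columns => /(nthP 0)[n ltn8 <-].
  have trs : [seq \tr M | M <- columns] = [:: ((1 + a) * 4)%:R; 0; 0; 0; 0; 0; 0; 0].
    rewrite /= /s /t !(mxtrace_tau A2E schemeA rankA) sigma1 mxtrace1 !mxtrace_sigma.
    (* A non-trivial power of the 4-cycle fixes no point. *)
    have tr0 i : (0 < i < 4)%N -> \tr (perm_mx (gx ^+ i)%g : 'M[F]_4) = 0.
      case: i => [|[|[|[|//]]]] // _; rewrite /mxtrace big1 // => p _;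
        rewrite !mxE !expgS expg0 mulg1 ?(permM gx) !gxE -val_eqE;
        by case: p => [[|[|[|[|//]]]] ?]; rewrite /= !inordK //= ?inordK.
    by rewrite !tr0 // -{1}[gx]expg1 tr0 // !mulr0.
  rewrite -(nth_map 0 0 (fun M => \tr M)) // trs.
  under eq_bigr => i do rewrite -(nth_map 0 0 (scheme_char i)) // scheme_char_columns.
  rewrite !big_ord_recl big_ord0 /scheme_mult /= natrM natrD.
  by case: n ltn8 => [|[|[|[|[|[|[|[|//]]]]]]]] _ /=; ring.
- rewrite mxtraceD mxtraceZ trE trE' mulr_sumr -big_split /=.
  by apply: eq_bigr => i _; rewrite psiD //; ring.
Qed.

Lemma scheme_char_frobenius i : frobenius_schur Q (scheme_char i) (scheme_mult i) =
  nth 0 [:: 1; 1; 1; 1; -1] i.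
Proof.
have NN : -1 * -1 = 1 :> F by rewrite mulrNN mulr1.
case: i => [[|[|[|[|[|//]]]]] ?]; rewrite /scheme_char /scheme_mult
  [nth _ _ _]/= [X in frobenius_schur _ _ X]/= [RHS]/=.
- exact: linear_char_frobenius_valency (mulr1 1) v10 Bv1.
- exact: linear_char_frobenius_valency NN v10 Bv1.
- exact: linear_char_frobenius_sum0 (mulr1 1) v20 Bv2.
- exact: linear_char_frobenius_sum0 NN v20 Bv2.
- exact: quaternion_char_frobenius.
Qed.

End Characters.

(** * Character table, multiplicities and indicators over the complex numbers *)

Lemma image_ord (T : Type) n (f : nat -> T) :
  [seq f i | i : 'I_n] = [seq f i | i <- iota 0 n].
Proof. by rewrite -val_enum_ord -map_comp. Qed.

Theorem proposition4p2 (R : realType) (a : nat) (A1 A2 : 'M[R[i]]_a)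
  (A2E : A2 = A1^T)
  (schemeA : association_scheme [fset 1%:M; A1; A2]%fset)
  (rankA : #|` [fset 1%:M; A1; A2]%fset| = 3%N)
  (nonsymA : ~ symmetric_scheme [fset 1%:M; A1; A2]%fset) :
  let n := (1 + a)%N in
  let Q := schemeQ A1 A2 in
  let s := @sigma R[i] a in
  let t := tau A1 A2 in
  let x := gx in
  let y := gy in
  let columns := [:: s 1%g; s (x ^+ 2)%g; s x; s (x ^+ 3)%g;
                     t (x * y)%g; t (x ^+ 3 * y)%g; t y; t (x ^+ 2 * y)%g] in
  let b : R[i] := a%:R in
  exists (phi : 'I_5 -> 'M[R[i]]_(n * 4) -> R[i]) (m : 'I_5 -> nat),
    [/\ irreducible_characters Q phi,
        [seq [seq phi i M | M <- columns] | i : 'I_5] =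
          [:: [:: 1;  1;  1;  1;  b;  b;  b;  b];
              [:: 1;  1; -1; -1;  b;  b; -b; -b];
              [:: 1;  1;  1;  1; -1; -1; -1; -1];
              [:: 1;  1; -1; -1; -1; -1;  1;  1];
              [:: 2; -2;  0;  0;  0;  0;  0;  0]],
        multiplicities Q phi m,
        [seq m i | i : 'I_5] = [:: 1; 1; a; a; n]%N
      & [seq frobenius_schur Q (phi i) (m i) | i : 'I_5] =
          [:: 1; 1; 1; 1; -1]].
Proof.
exists (scheme_char A1 A2), (@scheme_mult a); split.
- exact: scheme_char_irreducible.
(* Writing the rows through [nth] lets [image_ord] pass to natural number indices, where the list
   computes. *)
- transitivity [seq nth [::] (character_rows R[i] a) i | i : 'I_5].
    by apply: eq_map => i; exact: scheme_char_columns.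
  by rewrite image_ord.
- exact: scheme_char_multiplicities.
- by rewrite image_ord.
- transitivity ([seq nth 0 [:: 1; 1; 1; 1; -1] i | i : 'I_5] : seq R[i]).
    by apply: eq_map => i; exact: scheme_char_frobenius.
  by rewrite (image_ord _ (fun i => nth (0 : R[i]) [:: 1; 1; 1; 1; -1] i)).
Qed.
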